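(* The functions $f$ and $F$ extend to meromorphic functions on $\mathbb C$ (still denoted $f,F$) satisfying $$f(z+1)F(z)=1,\qquad f(z)=f(z+1)-\frac{1}{f(z+1)},\qquad z\in\mathbb C.$$ Both $f$ and $F$ are holomorphic in the half-plane $\Re z>-1$, and $z=-1$ is a pole of both $f$ and $F$. Moreover, $$\int_0^1 t^x\,d\mu(t)<\infty \text{ for every } x>-1,\qquad \int_0^1\frac{d\mu(t)}{t}=\infty.$$
   Context: Let $(m_n)_{n\ge0}$ be the unique sequence of positive reals with $m_0=1$ and $(1+m_1+\cdots+m_n)\,m_n=1$ for $n\ge1$ (equivalently $m_{n+1}^2+m_{n+1}/m_n-1=0$). It is a Hausdorff moment sequence: let $\mu$ (the ''fixed point measure'') be the unique probability measure on $[0,1]$ with $\int_0^1 t^n\,d\mu(t)=m_n$ for all $n\ge0$; it satisfies $\mu(\{0\})=\mu(\{1\})=0$. For $\Re z>0$ define the Bernstein transform $f(z)=\int_0^1\frac{1-t^z}{1-t}\,d\mu(t)$ and the Mellin transform $F(z)=\int_0^1 t^z\,d\mu(t)$, where $t^z=e^{z\log t}$ for $t>0$, $t^z:=0$ at $t=0$, and $\frac{1-t^z}{1-t}:=z$ at $t=1$. *)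

(* Defs.v *)
From HB Require Import structures.
From mathcomp Require Import all_boot all_order all_algebra.
From mathcomp Require Import all_classical all_reals all_analysis.
From mathcomp.real_closed Require Export complex.
Export Order.TTheory GRing.Theory Num.Theory.
Export numFieldNormedType.Exports ComplexField.

Set Implicit Arguments.
Unset Strict Implicit.
Unset Printing Implicit Defensive.

Local Open Scope ring_scope.
Local Open Scope classical_set_scope.
Local Open Scope complex_scope.

Section Defs.
Variable R : realType.

Definition cmod (z : R[i]) : R := Num.sqrt (complex.Re z ^+ 2 + complex.Im z ^+ 2).

(* t^z := e^{z log t} for t > 0, and t^z := 0 for t <= 0 (paper's convention at t = 0) *)
Definition cpow (t : R) (z : R[i]) : R[i] :=
  if 0 < t then
    (expR (complex.Re z * ln t) * cos (complex.Im z * ln t)) +i* (expR (complex.Re z * ln t) * sin (complex.Im z * ln t))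
  else 0.

Definition rpow (t x : R) : R := if 0 < t then expR (x * ln t) else 0.

Definition bkern (z : R[i]) (t : R) : R[i] :=
  if t == 1 then z else (1 - cpow t z) / (1 - t)%:C.

Definition cintegral (mu : {measure set R -> \bar R}) (D : set R) (h : R -> R[i]) : R[i] :=
  (Rintegral mu D (fun t => complex.Re (h t))) +i* (Rintegral mu D (fun t => complex.Im (h t))).

Definition bernstein (mu : {measure set R -> \bar R}) (z : R[i]) : R[i] :=
  cintegral mu `[0, 1]%classic (bkern z).

Definition mellin (mu : {measure set R -> \bar R}) (z : R[i]) : R[i] :=
  cintegral mu `[0, 1]%classic (fun t => cpow t z).

(* complex differentiability of f at z (scalars are R[i]) *)
Definition cdiff (f : R[i] -> R[i]) (z : R[i]) : Prop :=
  derivable (f : R[i]^o -> R[i]^o) z 1.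

Definition is_pole (f : R[i] -> R[i]) (s : R[i]) : Prop :=
  (fun w : R[i]^o => cmod (f w)) @ (s : R[i]^o)^' --> +oo.

Definition meromorphic (f : R[i] -> R[i]) (P : set R[i]) : Prop :=
  [/\ (forall z : R[i], exists2 r : R, 0 < r &
          forall w, P w -> cmod (w - z) < r -> w = z),
      (forall z, ~ P z -> cdiff f z) &
      (forall s, P s -> is_pole f s)].

End Defs.

(* Main.v *)
Require Import Defs.
From HB Require Import structures.
From mathcomp Require Import all_boot all_order all_algebra.
From mathcomp Require Import all_classical all_reals all_analysis.
From mathcomp.real_closed Require Import complex.
From mathcomp Require Import measurable_realfun.
From mathcomp Require Import ring lra.
Import Order.TTheory GRing.Theory Num.Theory.
Import numFieldNormedType.Exports ComplexField.
Local Open Scope ring_scope.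
Local Open Scope classical_set_scope.

Set Implicit Arguments.
Unset Strict Implicit.
Unset Printing Implicit Defensive.

(* Let psi(w) = w - 1/w. Pointwise, f(z+1) - f(z) = F(z), so everything rests on
   f(z+1) F(z) = 1 for Re z > 0. Since s^z (1-t^(z+1))/(1-t) is z+1 times the
   average of u^z over [st, s], this says that the functional sending h to the
   double mu-integral of the average of h over [st, s] is the integral of h over
   [0, 1]. For h = u^n this is the recursion (1 + m_1 + ... + m_n) m_n = 1, and
   Weierstrass approximation does the rest. Hence f(z) = psi(f(z+1)), and
   f(z) := psi^n(f(z+n)) extends f.

   The sign of Im is preserved by psi, and Im f(z+n) cannot vanish for all n when
   Im z <> 0: thus f takes nonreal values off the real line, and all zeros and
   poles are real. There f is increasing, so that its zeros are simple and
   isolated, and its poles are the points z with f(z+1) zero or infinite.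
   The values f(1) = 1 and f(0) = psi(1) = 0 give the pole at -1.

   Applied to decreasing h the functional shows that the mu-integral of h is at
   most its Lebesgue integral, whence the convergence for x > -1. Applied to the
   partial sums of sum_k (1-u)^k = 1/u it bounds the harmonic sums by the square
   of the mu-integral of 1/t, which is therefore infinite. *)

(** * Modulus, real part and imaginary part of complex numbers *)

Section ComplexModulus.
Variable R : realType.
Local Open Scope complex_scope.
Implicit Types z w : R[i].

Lemma normc_cmod z : `|z| = (cmod z)%:C.
Proof. by rewrite normc_def. Qed.

Lemma cmod_ge0 z : 0 <= cmod z.
Proof. exact: sqrtr_ge0. Qed.

Lemma cmodM z w : cmod (z * w) = cmod z * cmod w.
Proof. by apply: complexI; rewrite rmorphM/= -!normc_cmod normrM. Qed.

Lemma cmodN z : cmod (- z) = cmod z.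
Proof. by apply: complexI; rewrite -!normc_cmod normrN. Qed.

Lemma cmodV z : cmod z^-1 = (cmod z)^-1.
Proof. by apply: complexI; rewrite fmorphV/= -!normc_cmod normfV. Qed.

Lemma cmodD z w : cmod (z + w) <= cmod z + cmod w.
Proof. by rewrite -lecR rmorphD/= -!normc_cmod ler_normD. Qed.

Lemma cmod_real (x : R) : cmod x%:C = `|x|.
Proof. by rewrite /cmod/= expr0n/= addr0 sqrtr_sqr. Qed.

Lemma cmod_gt0 z : (0 < cmod z) = (z != 0).
Proof. by rewrite -ltcR -normc_cmod normr_gt0. Qed.

Lemma Re_le_cmod z : `|complex.Re z| <= cmod z.
Proof. by rewrite -lecR -normc_cmod normc_ge_Re. Qed.

Lemma Im_le_cmod z : `|complex.Im z| <= cmod z.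
Proof.
rewrite -(sqrtr_sqr (complex.Im z)) /cmod ler_sqrt ?lerDr ?sqr_ge0//.
by rewrite addr_ge0 ?sqr_ge0.
Qed.

Lemma cmod_le z : cmod z <= `|complex.Re z| + `|complex.Im z|.
Proof.
rewrite [in leLHS](complexE z) (le_trans (cmodD _ _))// cmodM !cmod_real.
by rewrite [X in _ + X * _]/cmod/= expr0n expr1n add0r sqrtr1 mul1r.
Qed.

Lemma ReD z w : complex.Re (z + w) = complex.Re z + complex.Re w.
Proof. by case: z w => ? ? []. Qed.
Lemma ImD z w : complex.Im (z + w) = complex.Im z + complex.Im w.
Proof. by case: z w => ? ? []. Qed.
Lemma ReN z : complex.Re (- z) = - complex.Re z.
Proof. by case: z. Qed.
Lemma ImN z : complex.Im (- z) = - complex.Im z.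
Proof. by case: z. Qed.
Lemma ReM z w : complex.Re (z * w) =
  complex.Re z * complex.Re w - complex.Im z * complex.Im w.
Proof. by case: z w => ? ? []. Qed.
Lemma ImM z w : complex.Im (z * w) =
  complex.Re z * complex.Im w + complex.Im z * complex.Re w.
Proof. by case: z w => ? ? [] ? ?; rewrite /= addrC addrC. Qed.
Lemma Re_nat n : complex.Re (n%:R : R[i]) = n%:R.
Proof. by rewrite -(rmorph_nat (real_complex R)). Qed.
Lemma Im_nat n : complex.Im (n%:R : R[i]) = 0.
Proof. by rewrite -(rmorph_nat (real_complex R)). Qed.

Lemma complex_ext z w : complex.Re z = complex.Re w ->
  complex.Im z = complex.Im w -> z = w.
Proof. by case: z w => ? ? [] ? ? /= -> ->. Qed.

End ComplexModulus.

(** * First-order bounds for [expR], [sin] and [cos] *)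

Section Elementary.
Variable R : realType.
Implicit Types a b m t L c : R.

(** Everything comes from $1 + a \le e^a$ and from the same inequality at $-a$, which reads $(1 - a)
    e^a \le 1$. *)
Lemma expR_sub1_le a : `|expR a - 1| <= `|a| * expR `|a|.
Proof.
have h1 := expR_ge1Dx a; have h2 := expR_ge1Dx (- a).
have h3 := expR_gt0 a.
have h4 : expR a - 1 <= a * expR a.
  have : (1 + - a) * expR a <= 1.
    rewrite -ler_pdivlMr// div1r -expRN; exact: h2.
  lra.
have h5 : expR a <= expR `|a| by rewrite ler_expR ler_norm.
have h6 : 1 <= expR `|a| by rewrite -[1]expR0 ler_expR.
have [a0|a0] := leP 0 a.
  by rewrite ger0_norm in h5 h6 *; [rewrite ger0_norm; lra|].
rewrite ltr0_norm// in h5 h6 *; rewrite ler0_norm; first nra.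
by rewrite subr_le0 expR_le1 ltW.
Qed.

Lemma expR_taylor1 a : `|expR a - 1 - a| <= a ^+ 2 * expR `|a|.
Proof.
have h1 := expR_ge1Dx a; have h2 := expR_ge1Dx (- a).
have h3 := expR_gt0 a.
have h4 : expR a - 1 - a <= a * (expR a - 1).
  have : (1 + - a) * expR a <= 1.
    rewrite -ler_pdivlMr// div1r -expRN; exact: h2.
  lra.
rewrite ger0_norm; last by lra.
apply: (le_trans h4); apply: (le_trans (ler_norm _)).
rewrite normrM -real_normK ?num_real// expr2 -mulrA ler_wpM2l//.
exact: expR_sub1_le.
Qed.

Lemma sin_le_norm b : `|sin b| <= `|b|.
Proof.
wlog b0 : b / 0 <= b.
  move=> H; have [/H//|/ltW b0] := leP 0 b.
  by rewrite -normrN -sinN -(normrN b) H// oppr_ge0.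
have [c _] := @MVT_segment R sin cos 0 b b0 (fun x _ => is_derive_sin x)
  (continuous_subspaceT (@continuous_sin R)).
rewrite sin0 !subr0 => ->; rewrite normrM -[leRHS]mul1r.
by rewrite ler_wpM2r// cos_max.
Qed.

Lemma cos_sub1_le b : `|cos b - 1| <= `|b|.
Proof.
wlog b0 : b / 0 <= b.
  move=> H; have [/H//|/ltW b0] := leP 0 b.
  by rewrite -cosN -(normrN b) H// oppr_ge0.
have [c _] := @MVT_segment R cos (fun x => - sin x) 0 b b0
  (fun x _ => is_derive_cos x) (continuous_subspaceT (@continuous_cos R)).
rewrite cos0 subr0 => ->; rewrite normrM normrN -[leRHS]mul1r.
by rewrite ler_wpM2r// sin_max.
Qed.

Lemma cos_sub1_le_sqr b : `|cos b - 1| <= `|b| ^+ 2.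
Proof.
wlog b0 : b / 0 <= b.
  move=> H; have [/H//|/ltW b0] := leP 0 b.
  by rewrite -cosN -(normrN b) H// oppr_ge0.
have [c] := @MVT_segment R cos (fun x => - sin x) 0 b b0
  (fun x _ => is_derive_cos x) (continuous_subspaceT (@continuous_cos R)).
rewrite cos0 subr0 in_itv/= => /andP[c0 cb] ->.
rewrite normrM normrN expr2 ler_wpM2r//.
rewrite (le_trans (sin_le_norm _))//.
by rewrite !ger0_norm// (le_trans c0).
Qed.

Lemma sin_sub_le b : `|sin b - b| <= `|b| ^+ 2.
Proof.
wlog b0 : b / 0 <= b.
  move=> H; have [/H//|/ltW b0] := leP 0 b.
  by rewrite -normrN opprB addrC -sinN -(normrN b) -[X in _ + X]opprK H// oppr_ge0.
have [c] := @MVT_segment R sin cos 0 b b0 (fun x _ => is_derive_sin x)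
  (continuous_subspaceT (@continuous_sin R)).
rewrite sin0 !subr0 in_itv/= => /andP[c0 cb] ->.
rewrite -[X in _ - X]mul1r -mulrBl normrM expr2 ler_wpM2r//.
rewrite (le_trans (cos_sub1_le _))//.
by rewrite !ger0_norm// (le_trans c0).
Qed.

End Elementary.

(** * Bounds on the logarithm and on real powers over the unit interval *)

Section LogBounds.
Variable R : realType.
Implicit Types x y t c : R.

Lemma ln_upper t : 0 < t -> 1 - t <= - ln t.
Proof. by move=> t0; have := expR_ge1Dx (ln t); rewrite lnK ?posrE//; lra. Qed.

Lemma Nln_ge0 t : 0 < t <= 1 -> 0 <= - ln t.
Proof. by move=> /andP[_ t1]; rewrite oppr_ge0 ln_le0. Qed.

(** With $L = -\ln t$ this is $t (1 + L) \le 1$, that is $1 + L \le e^L$. It bounds $L/(1-t)$ by $1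
    + L$, which controls the kernels near $t = 1$. *)
Lemma ln_lower t : 0 < t -> - ln t <= (1 - t) * (1 - ln t).
Proof.
move=> t0; have := expR_ge1Dx (- ln t); rewrite expRN lnK ?posrE// => h.
have : t * (1 - ln t) <= 1 by rewrite -ler_pdivlMl// mulr1.
nra.
Qed.

Lemma rpow_le1 t x : 0 <= t <= 1 -> 0 <= x -> rpow t x <= 1.
Proof.
move=> /andP[_ t1] x0; rewrite /rpow; case: ifP => // t0.
by rewrite expR_le1 mulr_ge0_le0// ln_le0.
Qed.

Lemma rpow_ge0 t x : 0 <= rpow t x.
Proof. by rewrite /rpow; case: ifP => // _; exact: expR_ge0. Qed.

Lemma rpow_nat t n : 0 < t -> rpow t n%:R = t ^+ n.
Proof. by move=> t0; rewrite /rpow t0 expRM_natl lnK. Qed.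

Lemma rpowD t x y : rpow t (x + y) = rpow t x * rpow t y.
Proof. by rewrite /rpow; case: ifP => _; rewrite ?mul0r// mulrDl expRD. Qed.

(* With [L = - ln t] this is [1 - e^(-xL) >= xL/(1+xL)], split at [L = 1]. *)
Lemma rpow_kernel_ge t x : 0 <= t < 1 -> 0 < x ->
  x / (1 + x) <= (1 - rpow t x) / (1 - t).
Proof.
move=> /andP[t0 t1] x0; have x10 : 0 < 1 + x by lra.
have t10 : 0 < 1 - t by lra.
rewrite ler_pdivrMr// mulrAC ler_pdivlMr//.
rewrite /rpow; case: ifPn => [tp|]; last first.
  by rewrite -leNgt => tn; nra.
have L0 : 0 <= - ln t by rewrite Nln_ge0// tp ltW.
have LB : 1 - t <= - ln t by exact: ln_upper.
set E := expR _.
have E0 : 0 <= E by exact: expR_ge0.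
have h : (1 + x * - ln t) * E <= 1.
  have := expR_ge1Dx (- (x * ln t)); rewrite expRN -/E => h.
  rewrite -ler_pdivlMr ?expR_gt0// div1r mulrN //.
have xL : 0 <= x * - ln t by rewrite mulr_ge0// ltW.
have E1 : E <= 1 by nra.
have [L1|L1] := leP (- ln t) 1.
  have : 0 <= (1 - E) * (x * (1 - (- ln t))).
    by rewrite !mulr_ge0 ?subr_ge0// ltW.
  have : x * (1 - t) <= x * - ln t by rewrite ler_pM2l.
  lra.
have : (1 + x) * E <= (1 + x * - ln t) * E.
  by rewrite ler_wpM2r// lerD2l ler_peMr ?ltW.
have : 0 <= x * t by rewrite mulr_ge0 ?ltW.
lra.
Qed.

(* [L (1 + L) e^(-2cL)] is bounded because [c L <= e^(cL)]. *)
Lemma log_sqr_rpow_le t c : 0 < t <= 1 -> 0 < c ->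
  - ln t * (1 - ln t) * rpow t (c + c) <= c^-1 * (1 + c^-1).
Proof.
move=> /andP[t0 t1] c0; rewrite rpowD /rpow t0.
have L0 : 0 <= - ln t by rewrite Nln_ge0// t0.
have := expR_ge1Dx (- (c * ln t)); rewrite expRN; set E := expR _ => h.
have E0 : 0 < E by exact: expR_gt0.
have E1 : E <= 1 by rewrite expR_le1 mulr_ge0_le0 ?(ltW c0) ?ln_le0.
have h' : (1 + c * - ln t) * E <= 1 by rewrite -ler_pdivlMr// div1r mulrN.
have a1 : - ln t * E <= c^-1.
  by rewrite -[leRHS]mulr1 ler_pdivlMl//; nra.
have a2 : (1 - ln t) * E <= 1 + c^-1.
  by rewrite mulrDl mul1r lerD.
have -> : - ln t * (1 - ln t) * (E * E) = (- ln t * E) * ((1 - ln t) * E) by ring.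
by rewrite ler_pM// ?mulr_ge0// ?ltW//; lra.
Qed.

End LogBounds.

(** * Complex powers of a real base, and the Bernstein kernel *)

Section ComplexPowers.
Variable R : realType.
Local Open Scope complex_scope.
Implicit Types (t : R) (z w h : R[i]).

Lemma cpow0 z : cpow 0 z = 0.
Proof. by rewrite /cpow ltxx. Qed.

Lemma cpow1 z : cpow 1 z = 1.
Proof. by rewrite /cpow ltr01 ln1 !mulr0 expR0 cos0 sin0 mulr1 mulr0. Qed.

Lemma cpowD t z w : cpow t (z + w) = cpow t z * cpow t w.
Proof.
rewrite /cpow; case: ifP => _; last by rewrite mulr0.
rewrite ReD ImD !mulrDl expRD cosD sinD.
by apply: complex_ext; rewrite /= ; ring.
Qed.

Lemma cpow_nat t n : 0 < t -> cpow t n%:R = (t ^+ n)%:C.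
Proof.
move=> t0; rewrite /cpow t0 Re_nat Im_nat mul0r cos0 sin0 mulr1 mulr0.
by rewrite expRM_natl lnK.
Qed.

Lemma cmod_cpow t z : cmod (cpow t z) = rpow t (complex.Re z).
Proof.
rewrite /cpow /rpow; case: ifP => _; last by rewrite cmod_real normr0.
by rewrite /cmod/= !exprMn -mulrDr cos2Dsin2 mulr1 sqrtr_sqr ger0_norm// expR_ge0.
Qed.

Lemma bkern0 z : bkern z 0 = 1.
Proof. by rewrite /bkern eq_sym oner_eq0 cpow0 !subr0 divr1. Qed.

Lemma bkern1 z : bkern z 1 = z.
Proof. by rewrite /bkern eqxx. Qed.

(** The numerators differ by $t^z (1 - t)$; at $t = 1$ the conventions agree, since $(z + 1) - z =
    1$. *)
Lemma bkernS t z : bkern (z + 1) t - bkern z t = cpow t z.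
Proof.
rewrite /bkern; case: eqP => [->|/eqP t1]; first by rewrite cpow1 addrC addrA addNr add0r.
have t1' : (1 - t)%:C != 0 :> R[i].
  by rewrite eq_complex/= eqxx andbT subr_eq0 eq_sym.
rewrite -mulrBl cpowD opprB addrC addrA subrK.
rewrite -[X in X - _]mulr1 -mulrBr.
have [t0|t0] := ltP 0 t; last by rewrite /cpow ltNge t0/= !mul0r.
rewrite -(_ : (1 - t)%:C = 1 - cpow t 1) ?mulfK//.
by rewrite (@cpow_nat t 1 t0) rmorphB rmorph1.
Qed.

End ComplexPowers.

(** * Integration over the unit interval against a probability measure concentrated there *)

Section UnitIntervalIntegral.
Variables (R : realType) (mu : probability R R).
Local Open Scope complex_scope.
Hypothesis muC : mu (~` `[0%R, 1%R]) = 0%E.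
Local Notation D := (`[0%R, 1%R]%classic : set R).
Local Notation I := (Rintegral mu D).
Local Notation itg g := (mu.-integrable D (EFin \o (g : R -> R))).
Implicit Types (g : R -> R) (u v : R -> R[i]).

Lemma unit_itv_prob : mu D = 1%E.
Proof.
have mD : measurable D by exact: measurable_itv.
have := probability_setC mu mD.
rewrite muC => /esym/eqP; rewrite -(fineK (fin_num_measure mu _ mD)) -EFinB.
by rewrite eqe subr_eq0 => /eqP <-.
Qed.

Lemma bounded_integrable01 g (C : R) : measurable_fun setT g ->
  (forall t, 0 <= t <= 1 -> `|g t| <= C) -> itg g.
Proof.
move=> mg gC; apply: measurable_bounded_integrable => //.
- exact: (eq_ind_r (fun x => (x < +oo)%E) (ltry 1) unit_itv_prob).
- exact: measurable_funTS.
- exists C; split; first exact: num_real.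
  move=> M CM t /=; rewrite in_itv/= => /gC H; exact: le_trans H (ltW CM).
Qed.

Lemma Rintegral01_cst (c : R) : I (cst c) = c.
Proof. rewrite Rintegral_cst// -[RHS]mulr1; congr (c * _); rewrite -[RHS]/(fine 1%E); congr fine; exact: unit_itv_prob. Qed.

Lemma le_Rintegral01 g1 g2 : itg g1 -> itg g2 ->
  (forall t, 0 <= t <= 1 -> g1 t <= g2 t) -> I g1 <= I g2.
Proof.
move=> i1 i2 H; apply: le_Rintegral => // t /=; rewrite in_itv/=; exact: H.
Qed.

Lemma eq_Rintegral01 g1 g2 : (forall t, 0 <= t <= 1 -> g1 t = g2 t) -> I g1 = I g2.
Proof.
move=> H; apply: eq_Rintegral => t; rewrite inE/= in_itv/=; exact: H.
Qed.

Lemma integrable01_cst (c : R) : itg (cst c).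
Proof. by apply: (@bounded_integrable01 _ `|c|) => // t _. Qed.

Lemma normr_Rintegral01_le g (c : R) : itg g ->
  (forall t, 0 <= t <= 1 -> `|g t| <= c) -> `|I g| <= c.
Proof.
move=> ig H; rewrite ler_norml; apply/andP; split.
  rewrite -[leLHS]Rintegral01_cst; apply: le_Rintegral01 => //; first exact: integrable01_cst.
  by move=> t /H; rewrite ler_norml => /andP[].
rewrite -[leRHS]Rintegral01_cst; apply: le_Rintegral01 => //; first exact: integrable01_cst.
by move=> t /H; rewrite ler_norml => /andP[].
Qed.

Lemma integrable01D g1 g2 : itg g1 -> itg g2 -> itg (fun t => g1 t + g2 t).
Proof. by move=> i1 i2; exact: (integrableD (measurable_itv _) i1 i2). Qed.

Lemma integrable01B g1 g2 : itg g1 -> itg g2 -> itg (fun t => g1 t - g2 t).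
Proof. by move=> i1 i2; exact: (integrableB (measurable_itv _) i1 i2). Qed.

Lemma integrable01Z (c : R) g : itg g -> itg (fun t => c * g t).
Proof. by move=> ig; exact: (integrableZl (measurable_itv _) c ig). Qed.

Lemma Rintegral01D g1 g2 : itg g1 -> itg g2 -> I (fun t => g1 t + g2 t) = I g1 + I g2.
Proof. exact: RintegralD. Qed.

Lemma Rintegral01B g1 g2 : itg g1 -> itg g2 -> I (fun t => g1 t - g2 t) = I g1 - I g2.
Proof. exact: RintegralB. Qed.

Lemma Rintegral01Z (c : R) g : itg g -> I (fun t => c * g t) = c * I g.
Proof. by move=> ig; exact: RintegralZl. Qed.

Lemma integrable01_sum n (g : nat -> R -> R) : (forall i, itg (g i)) ->
  itg (fun t => \sum_(i < n) g i t).
Proof.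
move=> H; elim: n => [|n IH].
  by under [X in EFin \o X]funext do rewrite big_ord0; exact: integrable01_cst.
by under [X in EFin \o X]funext do rewrite big_ord_recr/=; exact: integrable01D.
Qed.

Lemma Rintegral01_sum n (g : nat -> R -> R) : (forall i, itg (g i)) ->
  I (fun t => \sum_(i < n) g i t) = \sum_(i < n) I (g i).
Proof.
move=> H; elim: n => [|n IH].
  by rewrite big_ord0 -[RHS]Rintegral01_cst; apply: eq_Rintegral01 => t _; rewrite big_ord0.
rewrite big_ord_recr/= -IH -Rintegral01D//; last exact: integrable01_sum.
by apply: eq_Rintegral01 => t _; rewrite big_ord_recr.
Qed.

Lemma measurable_exprn n : measurable_fun setT (fun t : R => t ^+ n).
Proof. exact: exprn_measurable. Qed.

Lemma integrable01_exprn n : itg (fun t => t ^+ n).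
Proof.
apply: (@bounded_integrable01 _ 1); first exact: measurable_exprn.
by move=> t /andP[t0 t1]; rewrite ger0_norm ?exprn_ge0 ?exprn_ile1.
Qed.

Definition cintegrable01 u := itg (fun t => complex.Re (u t)) /\ itg (fun t => complex.Im (u t)).
Local Notation CI := (cintegral mu D).

Lemma cintegral01D u v : cintegrable01 u -> cintegrable01 v -> CI (fun t => u t + v t) = CI u + CI v.
Proof.
move=> [a b] [c d]; apply: complex_ext; rewrite ?ReD ?ImD/= -Rintegral01D//;
  by apply: eq_Rintegral01 => t _; rewrite ?ReD ?ImD.
Qed.

Lemma cintegral01Z z u : cintegrable01 u -> CI (fun t => z * u t) = z * CI u.
Proof.
move=> [a b]; apply: complex_ext; rewrite ?ReM ?ImM/= -?Rintegral01Z// -?Rintegral01B -?Rintegral01D//;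
  try exact: integrable01Z; by apply: eq_Rintegral01 => t _; rewrite ?ReM ?ImM.
Qed.

Lemma cintegrable01Z z u : cintegrable01 u -> cintegrable01 (fun t => z * u t).
Proof.
move=> [a b]; split.
  by under [X in EFin \o X]funext do rewrite ReM; apply: integrable01B; exact: integrable01Z.
by under [X in EFin \o X]funext do rewrite ImM; apply: integrable01D; exact: integrable01Z.
Qed.

Lemma cintegral01B u v : cintegrable01 u -> cintegrable01 v -> CI (fun t => u t - v t) = CI u - CI v.
Proof.
move=> cu cv; rewrite -[- CI v]mulN1r -cintegral01Z// -cintegral01D//; last exact: cintegrable01Z.
by congr (CI _); apply/funext => t; rewrite mulN1r.
Qed.

Lemma cintegrable01B u v : cintegrable01 u -> cintegrable01 v -> cintegrable01 (fun t => u t - v t).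
Proof.
move=> [a b] [c d]; split.
  by under [X in EFin \o X]funext do rewrite ReD ReN; exact: integrable01B.
by under [X in EFin \o X]funext do rewrite ImD ImN; exact: integrable01B.
Qed.

Lemma eq_cintegral01 u v : (forall t, 0 <= t <= 1 -> u t = v t) -> CI u = CI v.
Proof.
by move=> H; apply: complex_ext; apply: eq_Rintegral01 => t /H ->.
Qed.

(** Real and imaginary parts are estimated separately, hence a factor 2 in place of the sharp 1. *)
Lemma cmod_cintegral01_le u (c : R) : cintegrable01 u ->
  (forall t, 0 <= t <= 1 -> cmod (u t) <= c) -> cmod (CI u) <= c + c.
Proof.
move=> [a b] H; rewrite (le_trans (cmod_le _))// lerD//=; apply: normr_Rintegral01_le => // t /H.
  exact/le_trans/Re_le_cmod.
exact/le_trans/Im_le_cmod.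
Qed.

Definition cmeasurable u := measurable_fun setT (fun t => complex.Re (u t)) /\
  measurable_fun setT (fun t => complex.Im (u t)).

Lemma bounded_cintegrable01 u (c : R) : cmeasurable u ->
  (forall t, 0 <= t <= 1 -> cmod (u t) <= c) -> cintegrable01 u.
Proof.
move=> [a b] H; split; apply: (@bounded_integrable01 _ c) => // t /H.
  exact/le_trans/Re_le_cmod.
exact/le_trans/Im_le_cmod.
Qed.

End UnitIntervalIntegral.

(** * Measurability of the kernels, and bounds on them uniform in [t] *)

Section Kernels.
Variable R : realType.
Local Open Scope complex_scope.
Implicit Types (t : R) (z w h : R[i]).

Lemma measurable_funV (g : R -> R) : measurable_fun setT g ->
  measurable_fun setT (fun t => (g t)^-1).
Proof.
have minv : measurable_fun setT (fun x : R => x^-1).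
  (* On each half-line inversion is a power with exponent $-1$; the value [0^-1 = 0] belongs to the
     second branch. *)
  rewrite (_ : (fun x => _) =
      (fun x => if 0 < x then powR x (-1) else - powR (- x) (-1))); last first.
    apply/funext => x; case: ltP => x0; first by rewrite powR_inv1 ?ltW.
    by rewrite powR_inv1 ?oppr_ge0// invrN opprK.
  apply: measurable_fun_ifT.
  - exact: measurable_fun_ltr.
  - exact: measurable_powR.
  - apply: measurable_funN.
    have H : measurable_fun setT ((fun x : R => powR x (-1)) \o -%R).
      by apply: measurableT_comp => //; exact: measurable_powR.
    exact: H.
by move=> mg; exact: (measurableT_comp minv mg).
Qed.

Lemma cmeasurable_cst z : cmeasurable (fun=> z).
Proof. by split; exact: measurable_cst. Qed.

Lemma cmeasurable_real (g : R -> R) : measurable_fun setT g -> cmeasurable (fun t => (g t)%:C).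
Proof. by split => //; exact: measurable_cst. Qed.

Lemma cmeasurableM (u v : R -> R[i]) : cmeasurable u -> cmeasurable v -> cmeasurable (fun t => u t * v t).
Proof.
move=> [a b] [c d]; split.
  under eq_fun do rewrite ReM.
  by apply: measurable_funB; apply: measurable_funM.
under eq_fun do rewrite ImM.
by apply: measurable_funD; apply: measurable_funM.
Qed.

Lemma cmeasurableB (u v : R -> R[i]) : cmeasurable u -> cmeasurable v -> cmeasurable (fun t => u t - v t).
Proof.
move=> [a b] [c d]; split.
  by under eq_fun do rewrite ReD ReN; apply: measurable_funB.
by under eq_fun do rewrite ImD ImN; apply: measurable_funB.
Qed.

Lemma cmeasurable_if (p : R -> bool) (u v : R -> R[i]) : measurable_fun setT p ->
  cmeasurable u -> cmeasurable v -> cmeasurable (fun t => if p t then u t else v t).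
Proof.
move=> mp [a b] [c d]; split.
  rewrite (_ : (fun t => _) =
    fun t => if p t then complex.Re (u t) else complex.Re (v t)).
    exact: measurable_fun_ifT.
  by apply/funext => t; case: ifP.
rewrite (_ : (fun t => _) =
  fun t => if p t then complex.Im (u t) else complex.Im (v t)).
  exact: measurable_fun_ifT.
by apply/funext => t; case: ifP.
Qed.

Lemma cmeasurable_cpow z : cmeasurable (fun t => cpow t z).
Proof.
have mlin (c : R) : measurable_fun setT (fun t : R => c * ln t).
  by apply: measurable_funM => //; exact: measurable_ln.
have mexp : measurable_fun setT (fun t : R => expR (complex.Re z * ln t)).
  by apply: measurableT_comp => //; exact: measurable_expR.
rewrite /cpow; apply: cmeasurable_if.
- exact: measurable_fun_ltr.
- split => /=; apply: measurable_funM => //; apply: measurableT_comp => //.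
    exact: continuous_measurable_fun (@continuous_cos R).
  exact: continuous_measurable_fun (@continuous_sin R).
- exact: cmeasurable_cst.
Qed.

Lemma measurable_invB : measurable_fun setT (fun t : R => (1 - t)^-1).
Proof. by apply: measurable_funV; exact: measurable_funB. Qed.

Lemma cmeasurable_bkern z : cmeasurable (bkern z).
Proof.
rewrite /bkern; apply: cmeasurable_if; [exact: measurable_fun_eqr|exact: cmeasurable_cst|].
rewrite (_ : (fun t => _) = fun t => (1 - cpow t z) * ((1 - t)^-1)%:C); last first.
  by apply/funext => t; rewrite fmorphV.
apply: cmeasurableM; last by apply: cmeasurable_real; exact: measurable_invB.
by apply: cmeasurableB; [exact: cmeasurable_cst|exact: cmeasurable_cpow].
Qed.

(* The [z]-derivative of [bkern z t]. *)
Definition dkern z t : R[i] :=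
  if t == 1 then 1 else (- ln t)%:C * cpow t z / (1 - t)%:C.

Lemma cmeasurable_dkern z : cmeasurable (dkern z).
Proof.
rewrite /dkern; apply: cmeasurable_if; [exact: measurable_fun_eqr|exact: cmeasurable_cst|].
rewrite (_ : (fun t => _) =
    fun t => (- ln t)%:C * cpow t z * ((1 - t)^-1)%:C); last first.
  by apply/funext => t; rewrite fmorphV.
apply: cmeasurableM; last by apply: cmeasurable_real; exact: measurable_invB.
apply: cmeasurableM; last exact: cmeasurable_cpow.
by apply: cmeasurable_real; apply: measurable_funN; exact: measurable_ln.
Qed.

(** With $L = -\ln t$ and $E = t^c$, both $E$ and $(1 + cL) E$ are at most 1, because $1 + cL \le
    e^{cL}$. *)
Lemma log_rpow_le t c : 0 < t <= 1 -> 0 < c ->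
  (1 - ln t) * rpow t c <= 1 + c^-1.
Proof.
move=> /andP[t0 t1] c0; rewrite /rpow t0.
have L0 : 0 <= - ln t by rewrite Nln_ge0// t0.
have := expR_ge1Dx (- (c * ln t)); rewrite expRN; set E := expR _ => h.
have E0 : 0 < E by exact: expR_gt0.
have E1 : E <= 1 by rewrite expR_le1 mulr_ge0_le0 ?(ltW c0) ?ln_le0.
have h' : (1 + c * - ln t) * E <= 1 by rewrite -ler_pdivlMr// div1r mulrN.
rewrite mulrDl mul1r lerD//.
by rewrite -[leRHS]mulr1 ler_pdivlMl//; nra.
Qed.

Lemma cmod_cpow_le1 t z : 0 <= t <= 1 -> 0 <= complex.Re z -> cmod (cpow t z) <= 1.
Proof. by move=> t01 z0; rewrite cmod_cpow rpow_le1. Qed.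

Lemma cpow_sub1_le t z : 0 < t <= 1 -> 0 <= complex.Re z ->
  cmod (1 - cpow t z) <= 3 * cmod z * - ln t.
Proof.
move=> /andP[t0 t1] x0; have L0 : 0 <= - ln t by rewrite Nln_ge0// t0.
rewrite -cmodN opprB (le_trans (cmod_le _))// /cpow t0.
set x := complex.Re z; set y := complex.Im z.
rewrite ReD ImD ReN ImN/= oppr0 addr0.
have xz : x <= cmod z by rewrite (le_trans (ler_norm _))// Re_le_cmod.
have yz : `|y| <= cmod z by exact: Im_le_cmod.
have a0 : x * ln t <= 0 by rewrite mulr_ge0_le0// ln_le0.
have e0 := expR_gt0 (x * ln t).
have e1 : expR (x * ln t) <= 1 by rewrite expR_le1.
have e2 := expR_ge1Dx (x * ln t).
have b1 : `|y * ln t| = `|y| * - ln t.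
  by rewrite normrM (ler0_norm (_ : ln t <= 0))// ln_le0.
have h1 : `|expR (x * ln t) * cos (y * ln t) - 1| <= x * - ln t + `|y| * - ln t.
  rewrite (_ : _ - 1 = (expR (x * ln t) - 1) + expR (x * ln t) * (cos (y * ln t) - 1)); last by ring.
  rewrite (le_trans (ler_normD _ _))// lerD//.
    by rewrite ler0_norm ?subr_le0//; lra.
  rewrite normrM ger0_norm ?(ltW e0)// -b1.
  by rewrite (le_trans (ler_piMl _ e1))// cos_sub1_le.
have h2 : `|expR (x * ln t) * sin (y * ln t)| <= `|y| * - ln t.
  rewrite normrM ger0_norm ?(ltW e0)// -b1.
  by rewrite (le_trans (ler_piMl _ e1))// sin_le_norm.
have : x * - ln t <= cmod z * - ln t by rewrite ler_wpM2r.
have : `|y| * - ln t <= cmod z * - ln t by rewrite ler_wpM2r.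
lra.
Qed.

(** Let $L = -\ln t$. The bounds $3|z|L$ and $2$ for $|1 - t^z|$ combine into $|1 - t^z| (1 + L) \le
    (3|z| + 2) L$, and [ln_lower] turns $L$ into $(1 - t)(1 + L)$. *)
Lemma cmod_bkern_le t z : 0 <= t <= 1 -> 0 <= complex.Re z ->
  cmod (bkern z t) <= 3 * cmod z + 2.
Proof.
move=> /andP[t0 t1] x0; have z0 := cmod_ge0 z.
rewrite /bkern; case: eqP => [_|/eqP tn1]; first by lra.
have t1' : t < 1 by rewrite lt_neqAle tn1.
rewrite cmodM cmodV cmod_real ger0_norm ?subr_ge0// ler_pdivrMr ?subr_gt0//.
have h2 : cmod (1 - cpow t z) <= 2.
  rewrite (le_trans (cmodD _ _))// cmodN -[2]/(1 + 1) lerD//.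
    by rewrite -(rmorph1 (real_complex R)) cmod_real normr1.
  by rewrite cmod_cpow_le1// t0.
move: t0; rewrite le_eqVlt => /predU1P[t0|t0].
  move: h2; rewrite -t0 => h2; lra.
have t01 : 0 < t <= 1 by rewrite t0.
have L0 := Nln_ge0 t01; have := ln_lower t0; have := cpow_sub1_le t01 x0.
move: h2; set c := cmod (1 - _) => h2 h1 h3.
have c0 : 0 <= c by exact: cmod_ge0.
rewrite -(@ler_pM2r _ (1 - ln t)); last by lra.
rewrite -mulrA; have : c * (1 - ln t) <= (3 * cmod z + 2) * - ln t by nra.
move=> /le_trans; apply; rewrite ler_wpM2l//; lra.
Qed.

Lemma cmod_dkern_le t z : 0 <= t <= 1 -> 0 < complex.Re z ->
  cmod (dkern z t) <= 1 + (complex.Re z)^-1.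
Proof.
move=> /andP[t0 t1] x0; have xV : 0 < (complex.Re z)^-1 by rewrite invr_gt0.
rewrite /dkern; case: eqP => [_|/eqP tn1].
  by rewrite -(rmorph1 (real_complex R)) cmod_real normr1; lra.
have t1' : 0 < 1 - t by rewrite subr_gt0 lt_neqAle tn1.
move: t0; rewrite le_eqVlt => /predU1P[<-|t0].
  by rewrite cpow0 mulr0 mul0r cmod_real normr0; lra.
have t01 : 0 < t <= 1 by rewrite t0.
rewrite !cmodM cmodV !cmod_real cmod_cpow (ger0_norm (Nln_ge0 t01)).
rewrite (ger0_norm (ltW t1')) ler_pdivrMr//.
have := log_rpow_le t01 x0; have := ln_lower t0; have := rpow_ge0 t (complex.Re z).
move: (rpow _ _) => E E0 h1 h2.
rewrite (@le_trans _ _ ((1 - t) * ((1 - ln t) * E)))//.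
  by rewrite mulrA ler_wpM2r.
by rewrite mulrC ler_wpM2r// ltW.
Qed.

(** The quantity [m] bounds both the real and the imaginary part of $h \ln t$, and each of the two
    components of the remainder is at most $2 m^2 e^m$. *)
Lemma cpow_taylor1 t h : 0 < t <= 1 ->
  cmod (cpow t h - 1 - h * (ln t)%:C) <=
  4 * (cmod h * - ln t) ^+ 2 * expR (cmod h * - ln t).
Proof.
move=> t01; have L0 := Nln_ge0 t01; move/andP: t01 => [t0 t1].
set m := cmod h * _.
have m0 : 0 <= m by rewrite mulr_ge0// cmod_ge0.
rewrite (le_trans (cmod_le _))// /cpow t0 !ReD !ImD !ReN !ImN ReM ImM/=.
rewrite mulr0 !subr0 mulr0 add0r.
set a := complex.Re h * ln t; set b := complex.Im h * ln t.
have nL : `|ln t| = - ln t by rewrite -normrN ger0_norm.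
have am : `|a| <= m by rewrite normrM nL ler_wpM2r// Re_le_cmod.
have bm : `|b| <= m by rewrite normrM nL ler_wpM2r// Im_le_cmod.
have em : 1 <= expR m by rewrite -[1]expR0 ler_expR.
have ea : expR a <= expR m by rewrite ler_expR (le_trans (ler_norm _)).
have ea' : expR `|a| <= expR m by rewrite ler_expR.
have a2 : a ^+ 2 <= m ^+ 2 by rewrite -(real_normK (num_real a)) ler_sqr ?nnegrE.
have b2 : `|b| ^+ 2 <= m ^+ 2 by rewrite ler_sqr ?nnegrE.
have h1 : `|expR a * cos b - 1 - a| <= 2 * m ^+ 2 * expR m.
  rewrite (_ : _ - _ = (expR a - 1 - a) + expR a * (cos b - 1)); last by ring.
  rewrite (le_trans (ler_normD _ _))// -mulrA mulrDl mul1r lerD//.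
    by rewrite (le_trans (expR_taylor1 _))// ler_pM ?sqr_ge0 ?expR_ge0.
  rewrite normrM ger0_norm ?expR_ge0// mulrC ler_pM ?expR_ge0//.
  by rewrite (le_trans (cos_sub1_le_sqr _)).
have h2 : `|expR a * sin b - b| <= 2 * m ^+ 2 * expR m.
  rewrite (_ : _ - _ = (expR a - 1) * sin b + (sin b - b)); last by ring.
  rewrite (le_trans (ler_normD _ _))//.
  rewrite (_ : 2 * _ * _ = m ^+ 2 * expR m + m ^+ 2 * expR m); last by ring.
  apply: lerD.
    rewrite normrM expr2 mulrAC ler_pM//.
      by rewrite (le_trans (expR_sub1_le _))// ler_pM ?expR_ge0.
    by rewrite (le_trans (sin_le_norm _)).
  by rewrite (le_trans (sin_sub_le _))// (le_trans b2)// ler_peMr// sqr_ge0.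
by rewrite (le_trans (lerD h1 h2))//; lra.
Qed.

(** Let $L = -\ln t$. As $|h|$ is at most half of $\Re z$, the factor $e^{|h|L}$ costs only half of
    the decay of $t^z$ and leaves $t^{2c}$ with $c = \Re z/4$. One of the two factors $L$ is
    exchanged for $(1-t)(1+L)$, and [log_sqr_rpow_le] bounds the rest. *)
Lemma bkern_taylor1 t z h : 0 <= t <= 1 -> 0 < complex.Re z ->
  cmod h <= complex.Re z / 2 ->
  cmod (bkern (z + h) t - bkern z t - h * dkern z t) <=
  4 * ((complex.Re z / 4)^-1 * (1 + (complex.Re z / 4)^-1)) * cmod h ^+ 2.
Proof.
move=> /andP[t0 t1] x0 hx; set c := complex.Re z / 4.
have c0 : 0 < c by rewrite divr_gt0.
have C0 : 0 <= 4 * (c^-1 * (1 + c^-1)).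
  by rewrite !mulr_ge0 ?addr_ge0 ?invr_ge0 ?(ltW c0).
rewrite /bkern /dkern; case: eqP => [_|/eqP tn1].
  rewrite mulr1 (_ : z + h - z - h = 0); last by ring.
  rewrite cmod_real normr0.
  by rewrite mulr_ge0 ?sqr_ge0.
have t1' : 0 < 1 - t by rewrite subr_gt0 lt_neqAle tn1.
move: t0; rewrite le_eqVlt => /predU1P[<-|t0].
  rewrite !cpow0 mulr0 mul0r mulr0 subr0 subrr cmod_real normr0.
  by rewrite mulr_ge0 ?sqr_ge0.
have t01 : 0 < t <= 1 by rewrite t0.
rewrite cpowD rmorphN (_ : _ - _ - _ = - (cpow t z *
  (cpow t h - 1 - h * (ln t)%:C) / (1 - t)%:C)); last by ring.
rewrite cmodN 2!cmodM cmodV cmod_real (ger0_norm (ltW t1')) ler_pdivrMr//.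
have := cpow_taylor1 h t01; move: (cmod (_ - _)) => E HE.
rewrite cmod_cpow; set r := rpow _ _; have r0 : 0 <= r by exact: rpow_ge0.
have L0 := Nln_ge0 t01; have LL := ln_lower t0.
apply: (@le_trans _ _ (4 * cmod h ^+ 2 * (- ln t * - ln t *
    (r * expR (cmod h * - ln t))))).
  by rewrite (le_trans (ler_wpM2l r0 HE))// le_eqVlt; apply/orP; left; apply/eqP; ring.
have re : r * expR (cmod h * - ln t) <= rpow t (c + c).
  rewrite /r /rpow t0 -expRD ler_expR.
  have : (cmod h - complex.Re z / 2) * - ln t <= 0.
    by rewrite mulr_le0_ge0// subr_le0.
  rewrite /c; lra.
have := log_sqr_rpow_le t01 c0 => HC.
apply: (@le_trans _ _ (4 * cmod h ^+ 2 * ((1 - t) * (c^-1 * (1 + c^-1))))); last first.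
  by rewrite le_eqVlt; apply/orP; left; apply/eqP; ring.
apply: ler_wpM2l; first by rewrite mulr_ge0 ?sqr_ge0.
apply: (@le_trans _ _ (- ln t * - ln t * rpow t (c + c))).
  by rewrite ler_wpM2l// mulr_ge0.
apply: (@le_trans _ _ ((1 - t) * (- ln t * (1 - ln t) * rpow t (c + c)))); last first.
  by rewrite ler_wpM2l// ltW.
rewrite !mulrA ler_wpM2r ?rpow_ge0//.
by rewrite [leRHS]mulrAC ler_wpM2r.
Qed.

End Kernels.

(** * Complex derivatives, isolated zeros and poles *)

Section ComplexDerivative.
Variable R : realType.
Local Open Scope complex_scope.
Implicit Types (f g : R[i] -> R[i]) (z w h d : R[i]).

(** The annotation [^o] makes [R[i]] a normed module over itself, so that the derivative along 1 is
    the complex derivative. *)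
Definition cderive f z d :=
  is_derive (z : R[i]^o) (1 : R[i]^o) (f : R[i]^o -> R[i]^o) (d : R[i]^o).

Lemma cderive_cdiff f z d : cderive f z d -> cdiff f z.
Proof. by case. Qed.

Lemma gt0_complex_real (e : R[i]) : 0 < e -> exists2 r : R, 0 < r & e = r%:C.
Proof.
rewrite ltcE => /andP[/eqP i0 r0]; exists (complex.Re e) => //.
exact: complex_ext.
Qed.

Lemma cderive_cvg f z d :
  (fun h : R[i]^o => h^-1 * (f (h + z) - f z) : R[i]^o) @ (0 : R[i]^o)^' --> (d : R[i]^o) ->
  cderive f z d.
Proof.
move=> H.
have H' : (fun h : R[i]^o => h^-1 *: (((f : R[i]^o -> R[i]^o) \o shift (z : R[i]^o)) (h *: (1 : R[i]^o)) - (f z : R[i]^o))) @ (0 : R[i]^o)^' --> (d : R[i]^o).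
  apply: cvg_trans H; apply: near_eq_cvg; near=> h.
  by rewrite /= -[h *: 1]/(h * 1) mulr1.
apply: DeriveDef; last exact: cvg_lim H'.
by apply/cvg_ex; exists d.
Unshelve. all: by end_near. Qed.

Lemma cderive_lim f z d : cderive f z d ->
  (fun h : R[i]^o => h^-1 * (f (h + z) - f z) : R[i]^o) @ (0 : R[i]^o)^' --> (d : R[i]^o).
Proof.
move=> [/cvg_ex[l H] dd].
have <- : l = d by rewrite -dd; symmetry; exact: cvg_lim H.
apply: cvg_trans H; apply: near_eq_cvg; near=> h.
by rewrite /= -[h *: 1]/(h * 1) mulr1.
Unshelve. all: by end_near. Qed.

(** A quadratic remainder bound survives integration over [t], so differentiation under the integral
    sign reduces to a pointwise estimate. *)
Lemma cderive_taylor f z d (C r : R) : 0 < r ->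
  (forall h, cmod h <= r -> cmod (f (z + h) - f z - h * d) <= C * cmod h ^+ 2) ->
  cderive f z d.
Proof.
move=> r0 H; apply: cderive_cvg; apply/cvgrPdist_le => e /gt0_complex_real[e' e0 ->].
have C0 : 0 <= `|C| + 1 by rewrite addr_ge0.
near=> h.
have h0 : h != 0 by near: h; exact: nbhs_dnbhs_neq.
have hr : cmod h <= r.
  rewrite -lecR -normc_cmod; near: h; apply: dnbhs0_le; by rewrite ltcR.
have he : cmod h <= e' / (`|C| + 1).
  rewrite -lecR -normc_cmod; near: h; apply: dnbhs0_le.
  by rewrite ltcR divr_gt0// ltr_wpDl.
have c0 : 0 < cmod h by rewrite cmod_gt0.
have -> : d - h^-1 * (f (h + z) - f z) = - (h^-1 * (f (z + h) - f z - h * d)).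
  by rewrite (addrC h z) [in RHS]mulrBr mulKf// opprB.
rewrite normrN normrM normfV !normc_cmod -fmorphV -rmorphM lecR.
rewrite ler_pdivrMl// (le_trans (H _ hr))// expr2 mulrCA ler_wpM2l ?cmod_ge0//.
move: he; rewrite ler_pdivlMr ?ltr_wpDl// => he.
have := ler_norm C; nra.
Unshelve. all: by end_near. Qed.

Lemma cderive_continuous f z d : cderive f z d ->
  {for (z : R[i]^o), continuous (f : R[i]^o -> R[i]^o)}.
Proof.
by case=> H _; exact/differentiable_continuous/derivable1_diffP.
Qed.

Lemma cderive_ext f g z d : f =1 g -> cderive f z d -> cderive g z d.
Proof. by move=> /funext ->. Qed.

Lemma cderive_eq f z d d' : cderive f z d -> d = d' -> cderive f z d'.
Proof. by move=> H <-. Qed.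

Lemma cderiveD f g z d e : cderive f z d -> cderive g z e ->
  cderive (fun w => f w + g w) z (d + e).
Proof. by move=> Hf Hg; exact: (is_deriveD Hf Hg). Qed.

Lemma cderiveN f z d : cderive f z d -> cderive (fun w => - f w) z (- d).
Proof. by move=> Hf; exact: (is_deriveN Hf). Qed.

Lemma cderiveM f g z d e : cderive f z d -> cderive g z e ->
  cderive (fun w => f w * g w) z (f z * e + g z * d).
Proof. by move=> Hf Hg; exact: (is_deriveM Hf Hg). Qed.

Lemma cderive_cst c z : cderive (fun=> c) z 0.
Proof. exact: is_derive_cst. Qed.

Lemma cderiveV f z d : f z != 0 -> cderive f z d ->
  cderive (fun w => (f w)^-1) z (- (f z) ^- 2 * d).
Proof.
move=> f0 [H1 H2]; split; first exact: derivableV.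
by rewrite deriveV// H2.
Qed.

Lemma cderive_shift f z a d : cderive f (z + a) d -> cderive (fun w => f (w + a)) z d.
Proof.
move=> /cderive_lim H; apply: cderive_cvg.
by under eq_fun do rewrite -addrA.
Qed.

(** If $f(z) \ne 0$, continuity suffices. Otherwise the difference quotient is $f(w)/(w - z)$, which
    stays close to $d \ne 0$. *)
Lemma cderive_isolated f z d : cderive f z d -> f z != 0 \/ d != 0 ->
  exists2 r : R, 0 < r & forall w, cmod (w - z) < r -> w != z -> f w != 0.
Proof.
move=> H fd; have [fz0|fz0] := eqVneq (f z) 0; last first.
  have /cvgrPdist_lt/(_ `|f z|) := cderive_continuous H.
  rewrite normr_gt0 => /(_ fz0) [e /= /gt0_complex_real[r r0 ->] He].
  exists r => // w wr _; apply/eqP => fw0.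
  have : ball (z : R[i]^o) r%:C (w : R[i]^o).
    by rewrite -ball_normE/= distrC normc_cmod ltcR.
  by move=> /He/=; rewrite fw0 subr0 ltxx.
have d0 : d != 0 by case: fd => //; rewrite fz0 eqxx.
have /cvgrPdist_lt/(_ `|d|) := cderive_lim H.
rewrite normr_gt0 => /(_ d0) [e /= /gt0_complex_real[r r0 ->] He].
exists r => // w wr wz; apply/eqP => fw0.
have h0 : w - z != 0 by rewrite subr_eq0.
have : ball (0 : R[i]^o) r%:C (w - z : R[i]^o).
  by rewrite -ball_normE/= sub0r normrN normc_cmod ltcR.
by move=> /He/(_ h0)/=; rewrite subrK fw0 fz0 subr0 mulr0 subr0 ltxx.
Qed.

(** The inverse tends to 0 at [z]. That alone is not enough: since [0^-1 = 0], a zero of the inverse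
    near [z] would be a zero of [f]. The condition on [d] excludes such zeros. *)
Lemma pole_of_inv f z d : cderive (fun w => (f w)^-1) z d -> (f z)^-1 = 0 -> d != 0 ->
  is_pole f z.
Proof.
move=> H fz0 d0; have [r r0 Hr] := cderive_isolated H (or_intror d0).
apply/cvgryPge => A.
have c0 := cderive_continuous H.
have A0 : 0 < (`|A| + 1)^-1 by rewrite invr_gt0 ltr_wpDl.
have /cvgrPdist_lt/(_ (`|A| + 1)^-1%:C) := c0.
rewrite ltcR => /(_ A0) HA.
near=> w.
have wz : w != z by near: w; exact: nbhs_dnbhs_neq.
have wr : cmod (w - z) < r.
  rewrite -ltcR -normc_cmod -normrN opprB; near: w; apply: nbhs_dnbhs.
  apply: (@filterS _ _ _ (ball (z : R[i]^o) r%:C)).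
    by move=> x; rewrite -ball_normE.
  by apply: nbhsx_ballx; rewrite ltcR.
have fw0 := Hr w wr wz; rewrite invr_eq0 in fw0.
have : `|(f z)^-1 - (f w)^-1| < (`|A| + 1)^-1%:C.
  by near: w; apply: nbhs_dnbhs; exact: HA.
rewrite fz0 sub0r normrN normfV normc_cmod -fmorphV ltcR ltf_pV2 ?posrE ?cmod_gt0 ?ltr_wpDl//.
move=> h; have := ler_norm A; lra.
Unshelve. all: by end_near. Qed.

End ComplexDerivative.

(** * The Bernstein transform in the right half-plane: derivative, positivity, real values *)

Section MomentTransforms.
Variables (R : realType) (mu : probability R R) (m : nat -> R).
Local Open Scope complex_scope.
Hypothesis muC : mu (~` `[0%R, 1%R]) = 0%E.
Local Notation D := (`[0%R, 1%R]%classic : set R).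
Local Notation I := (Rintegral mu D).
Local Notation CI := (cintegral mu D).
Local Notation itg g := (mu.-integrable D (EFin \o (g : R -> R))).
Local Notation f0 := (bernstein mu).
Local Notation F0 := (mellin mu).
Implicit Types z w h : R[i].

Lemma cintegrable01_cpow z : 0 <= complex.Re z -> cintegrable01 mu (fun t => cpow t z).
Proof.
move=> z0; apply: (bounded_cintegrable01 muC (c := 1)); first exact: cmeasurable_cpow.
by move=> t t01; exact: cmod_cpow_le1.
Qed.

Lemma cintegrable01_bkern z : 0 <= complex.Re z -> cintegrable01 mu (bkern z).
Proof.
move=> z0; apply: (bounded_cintegrable01 muC (c := 3 * cmod z + 2)); first exact: cmeasurable_bkern.
by move=> t t01; exact: cmod_bkern_le.
Qed.

Lemma cintegrable01_dkern z : 0 < complex.Re z -> cintegrable01 mu (dkern z).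
Proof.
move=> z0; apply: (bounded_cintegrable01 muC (c := 1 + (complex.Re z)^-1)); first exact: cmeasurable_dkern.
by move=> t t01; exact: cmod_dkern_le.
Qed.

Lemma bernsteinS z : 0 <= complex.Re z -> f0 (z + 1) - f0 z = F0 z.
Proof.
move=> z0; rewrite -cintegral01B//; last 2 first.
- by apply: cintegrable01_bkern; rewrite ReD/=; lra.
- exact: cintegrable01_bkern.
by apply: eq_cintegral01 => t _; rewrite bkernS.
Qed.

Definition dbernstein z := CI (dkern z).

(** Differentiation under the integral sign: the estimate of [bkern_taylor1] is uniform in [t] and
    is integrated. *)
Lemma cderive_bernstein z : 0 < complex.Re z -> cderive f0 z (dbernstein z).
Proof.
move=> z0; set c := complex.Re z / 4.
(* The constant is twice that of [bkern_taylor1], the factor coming from [cmod_cintegral01_le]. *)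
apply: (@cderive_taylor _ _ _ _
  (4 * (c^-1 * (1 + c^-1)) + 4 * (c^-1 * (1 + c^-1))) (complex.Re z / 2)).
  by rewrite divr_gt0.
move=> h hz.
have zh : 0 <= complex.Re (z + h).
  have := Re_le_cmod h; rewrite ReD ler_norml => /andP[h1 _]; lra.
have z0' := ltW z0.
have ch : cintegrable01 mu (fun t => h * dkern z t) by apply: cintegrable01Z; exact: cintegrable01_dkern.
have cb : cintegrable01 mu (fun t => bkern (z + h) t - bkern z t).
  by apply: cintegrable01B; exact: cintegrable01_bkern.
rewrite -cintegral01Z; last exact: cintegrable01_dkern.
rewrite -cintegral01B; try exact: cintegrable01_bkern.
rewrite -cintegral01B// mulrDl; apply: (cmod_cintegral01_le muC); first exact: cintegrable01B.
by move=> t t01; exact: bkern_taylor1.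
Qed.

Lemma bernstein1 : f0 1 = 1.
Proof.
rewrite /bernstein (@eq_cintegral01 _ _ _ (fun=> 1)).
  by apply: complex_ext; rewrite /=; exact: (Rintegral01_cst muC).
move=> t /andP[t0 t1]; rewrite /bkern; case: eqP => // /eqP tn1.
have t1' : (1 - t)%:C != 0 :> R[i].
  by rewrite eq_complex/= eqxx andbT subr_eq0 eq_sym.
move: t0; rewrite le_eqVlt => /predU1P[<-|t0].
  by rewrite cpow0 !subr0 divr1.
by rewrite (@cpow_nat _ t 1)// expr1 -{1}(rmorph1 (real_complex R)) -rmorphB divff.
Qed.

Lemma bernstein_Im_real (x : R) : complex.Im (f0 x%:C) = 0.
Proof.
rewrite /= -[RHS](Rintegral01_cst muC); apply: eq_Rintegral01 => t _.
rewrite /bkern; case: ifP => // _.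
rewrite -fmorphV ImM/= mulr0 add0r ImD ImN.
by rewrite /cpow; case: ifP => _ /=; rewrite ?mul0r ?sin0 ?mulr0 ?subr0 ?oppr0 ?addr0 ?mul0r.
Qed.

(** Since $\Re t^z \le t^x$ with $x = \Re z$, the real part of the kernel is at least $(1 - t^x)/(1
    - t) \ge x/(1 + x)$. Hence $f$ has no zero in this half-plane. *)
Lemma bernstein_Re_gt0 z : 0 < complex.Re z -> 0 < complex.Re (f0 z).
Proof.
move=> z0; set x := complex.Re z.
have c0 : 0 < x / (1 + x) by rewrite divr_gt0// addr_gt0.
have c1 : x / (1 + x) <= x.
  by rewrite ler_pdivrMr ?addr_gt0// ler_peMr ?(ltW z0)// lerDl ltW.
rewrite (lt_le_trans c0)// -[leLHS](Rintegral01_cst muC); apply: le_Rintegral01 => //.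
- exact: integrable01_cst.
- by have [] := cintegrable01_bkern (ltW z0).
move=> t /andP[t0 t1]; rewrite /bkern; case: eqP => [_//|/eqP tn1].
have t1' : 0 < 1 - t by rewrite subr_gt0 lt_neqAle tn1.
have := @rpow_kernel_ge _ t x; rewrite t0 lt_neqAle tn1 t1 => /(_ isT z0) /le_trans; apply.
rewrite -fmorphV ReM/= mulr0 subr0 ler_wpM2r ?invr_ge0 ?(ltW t1')// ReD ReN/=.
rewrite lerD2l lerN2 -cmod_cpow (le_trans (ler_norm _))//; exact: Re_le_cmod.
Qed.

Hypothesis hm : forall n : nat,
  (\int[mu]_(t in `[0%R, 1%R]) (t ^+ n)%:E = (m n)%:E)%E.
Hypothesis m_gt0 : forall n, 0 < m n.

Lemma Rintegral01_exprn n : I (fun t => t ^+ n) = m n.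
Proof. by rewrite /Rintegral hm. Qed.

(** For $0 < t < 1$ the kernel $-\ln t \, t^x/(1-t)$ is at least $t^x \ge t^n$ when $n \ge x$, so
    the derivative is at least $m_n > 0$. *)
Lemma dbernstein_real (x : R) : 0 < x ->
  exists2 d : R, 0 < d & dbernstein x%:C = d%:C.
Proof.
move=> x0; have cd : cintegrable01 mu (dkern x%:C) by exact: cintegrable01_dkern.
exists (complex.Re (dbernstein x%:C)); last first.
  apply: complex_ext => //=; rewrite -[RHS](Rintegral01_cst muC); apply: eq_Rintegral01 => t _.
  rewrite /dkern; case: ifP => // _; rewrite -fmorphV.
  by rewrite /cpow; case: ifP => _; rewrite !(ImM, ReM)/= ?mul0r ?sin0; ring.
(* The successor makes [n] positive, so that $t^n$ vanishes at $t = 0$, where [dkern] is 0. *)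
pose n := (Num.bound x).+1.
have xn : x <= n%:R.
  by rewrite ltW// (lt_le_trans (archi_boundP (ltW x0)))// ler_nat.
rewrite (lt_le_trans (m_gt0 n))// -Rintegral01_exprn; apply: le_Rintegral01 => //.
- exact: integrable01_exprn.
- by case: cd.
move=> t /andP[t0 t1]; rewrite /dkern; case: eqP => [->|/eqP tn1].
  by rewrite expr1n.
have t1' : 0 < 1 - t by rewrite subr_gt0 lt_neqAle tn1.
move: t0; rewrite le_eqVlt => /predU1P[<-|t0].
  by rewrite expr0n cpow0 mulr0 mul0r.
rewrite -fmorphV /cpow t0 !(ReM, ImM)/= !mul0r cos0 mulr1 mulr0 !subr0.
rewrite -rpow_nat// /rpow t0.
apply: (@le_trans _ _ (expR (x * ln t))).
  by rewrite ler_expR; have := ln_le0 t1; nra.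
rewrite -[leLHS]mul1r mulrAC ler_wpM2r ?expR_ge0// ler_pdivlMr// mul1r.
exact: ln_upper.
Qed.

End MomentTransforms.

(** * Weierstrass approximation by Bernstein polynomials *)

Section Weierstrass.
Variable R : realType.
Implicit Types (g : nat -> R) (h : R -> R) (u c e : R).

(* [(bernstein_poly n g).[u]] is the mean of [g] under the binomial law of
   parameters [n] and [u], computed by conditioning on the first trial. *)
Fixpoint bernstein_poly n g : {poly R} :=
  if n is n'.+1 then
    'X * bernstein_poly n' (fun k => g k.+1) + (1 - 'X) * bernstein_poly n' g
  else (g 0%N)%:P.
Local Notation B n g u := ((bernstein_poly n g).[u]).

Lemma bernstein_polyS n g u :
  B n.+1 g u = u * B n (fun k => g k.+1) u + (1 - u) * B n g u.
Proof. by rewrite /= !hornerE. Qed.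

Lemma bernstein_poly_le n g1 g2 u : 0 <= u <= 1 ->
  (forall k, (k <= n)%N -> g1 k <= g2 k) -> B n g1 u <= B n g2 u.
Proof.
move=> /andP[u0 u1]; elim: n g1 g2 => [|n IH] g1 g2 H; first by rewrite /= !hornerE H.
rewrite !bernstein_polyS lerD// ler_wpM2l ?subr_ge0// IH// => k kn; apply: H => //.
exact: leqW.
Qed.

Lemma bernstein_poly_affine n g a b u :
  B n (fun k => a + b * g k) u = a + b * B n g u.
Proof.
elim: n g => [|n IH] g; first by rewrite /= !hornerE.
by rewrite !bernstein_polyS !IH; ring.
Qed.

(** Variance of the binomial law plus the square of the distance from its mean $nu$ to $c$. *)
Lemma bernstein_poly_sqr n c u :
  B n (fun k => (k%:R - c) ^+ 2) u = n%:R * (u * (1 - u)) + (n%:R * u - c) ^+ 2.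
Proof.
elim: n c => [|n IH] c; first by rewrite /= hornerC; ring.
rewrite bernstein_polyS IH.
rewrite (_ : (fun k => (k.+1%:R - c) ^+ 2) = fun k => (k%:R - (c - 1)) ^+ 2).
  by rewrite IH -natr1; ring.
by apply/funext => k; rewrite -natr1; congr (_ ^+ 2); ring.
Qed.

(** Heine's theorem from compactness in its near-covering form, the filter of small positive [d]
    providing the common radius. *)
Lemma uniformly_continuous01 h e : 0 < e ->
  (forall x, 0 <= x <= 1 -> {for x, continuous h}) ->
  exists2 d, 0 < d & forall u v, 0 <= u <= 1 -> 0 <= v <= 1 ->
    `|u - v| < d -> `|h u - h v| <= e.
Proof.
move=> e0 hc.
have := @segment_compact R 0 1; rewrite compact_near_coveringP.
move=> /(_ R (0 : R)^'+ (fun d u => forall v, `|u - v| < d -> `|h u - h v| <= e) _).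
move=> []; last first.
  move=> d /= d0 Hd.
  exists (d / 2); first by rewrite divr_gt0.
  move=> u v u01 v01 uv; apply: (Hd (d / 2)) => //=.
  - rewrite sub0r normrN ger0_norm; [lra|lra].
  - by lra.
move=> x; rewrite /= in_itv/= => /hc /cvgrPdist_lt /(_ (e / 2)).
rewrite divr_gt0// => /(_ isT) [d /= d0 Hd].
exists (ball x (d / 2), [set y | 0 < y < d / 2]).
  split; first by apply: nbhsx_ballx; rewrite divr_gt0.
  exists (d / 2) => /=; first by rewrite divr_gt0.
  move=> y /=; rewrite sub0r normrN => yd y0; rewrite y0/=.
  by rewrite (le_lt_trans (ler_norm _)).
move=> [u y] /= [xu /andP[y0 yd]] v uv.
have xu' : `|x - u| < d / 2 by exact: xu.
have h1 : `|h x - h u| < e / 2.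
  by apply: Hd => /=; lra.
have h2 : `|h x - h v| < e / 2.
  apply: Hd => /=; rewrite (_ : x - v = (x - u) + (u - v)); last by ring.
  by rewrite (le_lt_trans (ler_normD _ _))//; lra.
rewrite (_ : h u - h v = (h x - h v) - (h x - h u)); last by ring.
by rewrite (le_trans (ler_normB _ _))//; lra.
Qed.

(** Bernstein's proof: $|h(u) - h(v)| \le e/2 + K (u - v)^2$ on the whole interval. Taking the
    binomial mean in $v = k/n$, which preserves inequalities, turns the square into the variance
    $u(1-u)/n$, and $K/n \le e/2$. *)
Lemma weierstrass h e : 0 < e -> (forall x, 0 <= x <= 1 -> {for x, continuous h}) ->
  exists p : {poly R}, forall u, 0 <= u <= 1 -> `|p.[u] - h u| <= e.
Proof.
move=> e0 hc; have e20 : 0 < e / 2 by rewrite divr_gt0.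
have [d d0 Hd] := uniformly_continuous01 e20 hc.
have [M M0 HM] : exists2 M, 0 < M & forall u, 0 <= u <= 1 -> `|h u| <= M.
  have cw : {within `[0, 1]%classic, continuous h}.
    by apply: continuous_in_subspaceT => x; rewrite inE/= in_itv/= => /hc.
  have [c1 _ H1] := EVT_max ler01 cw; have [c2 _ H2] := EVT_min ler01 cw.
  exists (`|h c1| + `|h c2| + 1); first by rewrite ltr_wpDl// addr_ge0.
  move=> u u01; have := H1 u; rewrite in_itv/= => /(_ u01) a1.
  have := H2 u; rewrite in_itv/= => /(_ u01) a2.
  have b1 := ler_norm (h c1); have b2 := ler_norm (- h c2); rewrite normrN in b2.
  have b3 := normr_ge0 (h c1); have b4 := normr_ge0 (h c2).
  by rewrite ler_norml; apply/andP; split; lra.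
(* At distance at least [d] the term $K (u - v)^2$ exceeds $2M$, hence any difference of values. *)
pose K := 2 * M / d ^+ 2.
have K0 : 0 < K by rewrite divr_gt0 ?exprn_gt0// mulr_gt0.
have HK u v : 0 <= u <= 1 -> 0 <= v <= 1 -> `|h u - h v| <= e / 2 + K * (u - v) ^+ 2.
  move=> u01 v01; have [uv|uv] := ltP `|u - v| d.
    by rewrite (le_trans (Hd _ _ _ _ uv))// lerDl mulr_ge0 ?sqr_ge0 ?(ltW K0).
  rewrite (le_trans (ler_normB _ _))//.
  have : 2 * M <= K * (u - v) ^+ 2.
    rewrite /K mulrAC ler_pdivlMr ?exprn_gt0// ler_wpM2l ?mulr_ge0 ?(ltW M0)//.
    by rewrite -(real_normK (num_real (u - v))) ler_sqr ?nnegrE ?(ltW d0).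
  have := HM _ u01; have := HM _ v01; lra.
pose n := (Num.bound (K / (e / 2))).+1.
have n0 : 0 < n%:R :> R by rewrite ltr0n.
have Kn : K / n%:R <= e / 2.
  rewrite ler_pdivrMr// -ler_pdivrMl// mulrC ltW//.
  rewrite (lt_le_trans (archi_boundP _)) ?ler_nat//.
  by rewrite divr_ge0// ltW.
exists (bernstein_poly n (fun k => h (k%:R / n%:R))) => u u01.
have u0 : 0 <= u by case/andP: u01.
have u1 : u <= 1 by case/andP: u01.
have kn k : (k <= n)%N -> 0 <= (k%:R / n%:R : R) <= 1.
  by move=> kn; rewrite divr_ge0//= ler_pdivrMr// mul1r ler_nat.
have E : e / 2 + K / n%:R ^+ 2 * B n (fun k => (k%:R - n%:R * u) ^+ 2) u <= e.
  rewrite bernstein_poly_sqr subrr expr0n addr0.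
  rewrite (_ : K / n%:R ^+ 2 * _ = K / n%:R * (u * (1 - u))); last by field; rewrite gt_eqF.
  have : K / n%:R * (u * (1 - u)) <= e / 2 * 1 by rewrite ler_pM ?divr_ge0 ?mulr_ge0 ?subr_ge0 ?ler0n ?(ltW K0)//; nra.
  lra.
have Hk k : (k <= n)%N -> `|h (k%:R / n%:R) - h u| <=
    e / 2 + K / n%:R ^+ 2 * (k%:R - n%:R * u) ^+ 2.
  move=> /kn k01; rewrite (le_trans (HK _ _ k01 u01))// lerD2l.
  rewrite (_ : K / n%:R ^+ 2 * _ = K * (k%:R / n%:R - u) ^+ 2)//.
  by field; rewrite gt_eqF.
rewrite ler_norml; apply/andP; split.
  suff : h u - e <= B n (fun k => h (k%:R / n%:R)) u by lra.
  apply: (@le_trans _ _ (B n (fun k => (h u - e / 2) + (- (K / n%:R ^+ 2)) * (k%:R - n%:R * u) ^+ 2) u)).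
    by rewrite bernstein_poly_affine mulNr; lra.
  apply: bernstein_poly_le => // k /Hk; rewrite ler_norml mulNr => /andP[]; lra.
suff : B n (fun k => h (k%:R / n%:R)) u <= h u + e by lra.
apply: (@le_trans _ _ (B n (fun k => (h u + e / 2) + (K / n%:R ^+ 2) * (k%:R - n%:R * u) ^+ 2) u)).
  apply: bernstein_poly_le => // k /Hk; rewrite ler_norml => /andP[]; lra.
by rewrite bernstein_poly_affine; lra.
Qed.

End Weierstrass.

(** * Averages of polynomials over segments *)

Section Averages.
Variable R : realType.
Implicit Types (p : {poly R}) (s t u : R) (h H : R -> R).

(* The average of [p] over the segment with endpoints [s t] and [s]. *)
Definition avg p s t : R :=
  \sum_(i < size p) p`_i / i.+1%:R * s ^+ i * \sum_(j < i.+1) t ^+ j.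

Definition primitive p : {poly R} := \sum_(i < size p) (p`_i / i.+1%:R) *: 'X^(i.+1).

Lemma deriv_primitive p : deriv (primitive p) = p.
Proof.
rewrite /primitive raddf_sum/= -[RHS]coefK poly_def; apply: eq_bigr => i _.
by rewrite derivZ derivXn /= -scalerMnr scalerMnl -mulr_natr divfK// pnatr_eq0.
Qed.

Lemma avg_primitive p s t :
  s * (1 - t) * avg p s t = (primitive p).[s] - (primitive p).[s * t].
Proof.
rewrite /primitive !horner_sum -sumrB /avg mulr_sumr; apply: eq_bigr => i _.
rewrite !hornerE exprMn -mulrBr.
have := subrX1 t i.+1 => E.
rewrite (_ : s ^+ i.+1 - s ^+ i.+1 * t ^+ i.+1 = - s ^+ i.+1 * (t ^+ i.+1 - 1)); last by ring.
by rewrite /= E exprS; ring.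
Qed.

Lemma avg0 p t : avg p 0 t = p.[0].
Proof.
rewrite horner_coef; apply: eq_bigr => -[[|i] Hi] _ /=; last by rewrite expr0n !(mulr0, mul0r).
by rewrite big_ord1 !expr0 !mulr1 divr1.
Qed.

Lemma avg1 p s : avg p s 1 = p.[s].
Proof.
rewrite horner_coef; apply: eq_bigr => i _.
under eq_bigr do rewrite expr1n.
by rewrite sumr_const card_ord -[1 *+ _]/(_%:R) mulrAC divfK// pnatr_eq0.
Qed.

(** The mean value theorem for the primitive. For $s = 0$ or $t = 1$ the segment is a point, and the
    average is the value there. *)
Lemma avg_mvt p s t : 0 <= s -> 0 <= t <= 1 ->
  exists2 u, s * t <= u <= s & avg p s t = p.[u].
Proof.
move=> s0 /andP[t0 t1].
have [->|sn0] := eqVneq s 0; first by exists 0; rewrite ?mul0r ?lexx// avg0.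
have [->|tn1] := eqVneq t 1; first by exists s; rewrite ?mulr1 ?lexx// avg1.
have sp : 0 < s by rewrite lt_neqAle eq_sym sn0.
have tp : t < 1 by rewrite lt_neqAle tn1.
have sts : s * t < s by rewrite gtr_pMr.
have [u] := @MVT R (horner (primitive p)) (horner (deriv (primitive p))) (s * t) s sts
  (fun x _ => is_derive_poly _ x) (continuous_subspaceT (@continuous_horner R _)).
rewrite -avg_primitive in_itv/= => /andP[u1 u2].
rewrite (_ : s - s * t = s * (1 - t)); last by ring.
rewrite [RHS]mulrC deriv_primitive => E; exists u; first by rewrite !ltW.
by apply: mulfI E; rewrite mulf_neq0// subr_eq0 eq_sym.
Qed.

(** The mean value theorem, applied to the primitive of [p] minus [H], identifies the difference of
    the two averages with $p - h$ at a single point. *)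
Lemma avg_close p H h e s t : 0 < s <= 1 -> 0 <= t < 1 ->
  (forall x : R, 0 < x < 1 -> is_derive (x : R) (1 : R) H (h x)) ->
  (forall x, 0 <= x <= 1 -> {for x, continuous H}) ->
  (forall x, 0 <= x <= 1 -> `|p.[x] - h x| <= e) ->
  `|avg p s t - (H s - H (s * t)) / (s * (1 - t))| <= e.
Proof.
move=> /andP[s0 s1] /andP[t0 t1] dH cH ph.
have sts : s * t < s by rewrite gtr_pMr.
have st0 : 0 <= s * t by rewrite mulr_ge0// ltW.
have w0 : 0 < s * (1 - t) by rewrite mulr_gt0// subr_gt0.
have dG : forall x : R, x \in `](s * t), s[%R -> is_derive (x : R) (1 : R)
    (horner (primitive p) - H) ((deriv (primitive p)).[x] - h x).
  move=> x; rewrite in_itv/= => /andP[x1 x2]; apply: is_deriveB.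
  by apply: dH; rewrite (le_lt_trans st0 x1) (lt_le_trans x2 s1).
have cG : {within `[(s * t), s]%classic, continuous (horner (primitive p) - H)}.
  apply: continuous_in_subspaceT => x; rewrite inE/= in_itv/= => /andP[x1 x2].
  apply: continuousB; first exact: continuous_horner.
  by apply: cH; rewrite (le_trans st0 x1) (le_trans x2 s1).
have [u] := MVT sts dG cG.
rewrite in_itv/= deriv_primitive => /andP[u1 u2] E.
have -> : avg p s t - (H s - H (s * t)) / (s * (1 - t)) = p.[u] - h u.
  apply: (@mulIf _ (s * (1 - t))); first by rewrite gt_eqF.
  rewrite mulrBl divfK ?gt_eqF// mulrC avg_primitive.
  rewrite (_ : s * (1 - t) = s - s * t); last by ring.
  by rewrite -E/= ; rewrite !fctE; ring.
by apply: ph; rewrite (le_trans st0 (ltW u1)) (le_trans (ltW u2) s1).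
Qed.

End Averages.

(** * Complex powers as functions of their base *)

Section CpowBase.
Variable R : realType.
Local Open Scope complex_scope.
Implicit Types (u s t : R) (z w : R[i]).

Lemma Re_realM (x : R) w : complex.Re (x%:C * w) = x * complex.Re w.
Proof. by rewrite ReM mul0r subr0. Qed.

(** The mean value theorem and polynomial approximation act on real functions; letting the weight
    [w] vary recovers complex identities from real parts. *)
Lemma is_derive_Re_cpow w z u : 0 < u ->
  is_derive (u : R) (1 : R) (fun v : R => complex.Re (w * cpow v z))
    (complex.Re (w * z * cpow u z) / u).
Proof.
move=> u0.
have dl (c : R) : is_derive (u : R) (1 : R) (c *: @ln R) (c *: u^-1).
  by apply: is_deriveZ; exact: is_derive1_ln.
set X := complex.Re z; set Y := complex.Im z.
have dE := is_derive1_comp (is_derive_expR ((X *: @ln R) u)) (dl X).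
have dC := is_derive1_comp (is_derive_cos ((Y *: @ln R) u)) (dl Y).
have dS := is_derive1_comp (is_derive_sin ((Y *: @ln R) u)) (dl Y).
have dEC := is_deriveZ (complex.Re w) (is_deriveM dE dC).
have dES := is_deriveZ (complex.Im w) (is_deriveM dE dS).
have := is_deriveB dEC dES => dT.
have dT' := is_derive_eq dT (_ : _ = complex.Re (w * z * cpow u z) / u).
apply: (near_eq_is_derive _ (dT' _)); last first.
  rewrite /cpow u0 !(ReM, ImM)/= -/X -/Y.
  have eX : (X *: @ln R) u = X * ln u by [].
  have eY : (Y *: @ln R) u = Y * ln u by [].
  by rewrite eX eY /GRing.scale/=; field; rewrite gt_eqF.
near=> v; have v0 : 0 < v by near: v; exact: lt_nbhsr.
by rewrite /cpow v0 ReM.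
Unshelve. all: by end_near. Qed.

Lemma cpowM s t z : 0 < s -> cpow (s * t) z = cpow s z * cpow t z.
Proof.
move=> s0; rewrite /cpow pmulr_rgt0// s0; case: ifP => t0; last by rewrite mulr0.
rewrite lnM ?posrE// !mulrDr expRD cosD sinD.
by apply: complex_ext; rewrite /=; ring.
Qed.

Lemma continuous_Re_cpow w z u : 0 < complex.Re z ->
  {for u, continuous (fun v : R => complex.Re (w * cpow v z))}.
Proof.
move=> z0; have [u0|u0] := ltP 0 u.
  have [+ _] := is_derive_Re_cpow w z u0.
  by move=> /derivable1_diffP/differentiable_continuous.
have E v : v <= 0 -> complex.Re (w * cpow v z) = 0.
  by move=> v0; rewrite /cpow ltNge v0/= mulr0.
apply/cvgrPdist_lt => e e0; rewrite E// .
have w0 : 0 < cmod w + 1 by rewrite ltr_wpDl ?cmod_ge0.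
(* The solution of $(|w| + 1) d^{\Re z} = e$. *)
pose d := expR (ln (e / (cmod w + 1)) / complex.Re z).
near=> v; rewrite sub0r normrN; have [v0|v0] := ltP 0 v; last by rewrite E// normr0.
have vd : v < d.
  by near: v; apply: lt_nbhsl; rewrite (le_lt_trans u0)// expR_gt0.
rewrite (le_lt_trans (Re_le_cmod _))// cmodM cmod_cpow /rpow v0.
have h : expR (complex.Re z * ln v) < e / (cmod w + 1).
  rewrite -ltr_ln ?posrE ?expR_gt0 ?divr_gt0// expRK mulrC -ltr_pdivlMr//.
  by rewrite -ltr_expR lnK ?posrE.
rewrite (@le_lt_trans _ _ (cmod w * (e / (cmod w + 1))))// ?ler_wpM2l ?cmod_ge0 ?(ltW h)//.
rewrite mulrA ltr_pdivrMr// mulrC ltr_pM2l//; lra.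
Unshelve. all: by end_near. Qed.

End CpowBase.

(** * The identity $f(z+1) F(z) = 1$ from the moment recursion *)

Section MomentIdentity.
Variables (R : realType) (mu : probability R R) (m : nat -> R).
Local Open Scope complex_scope.
Hypothesis muC : mu (~` `[0%R, 1%R]) = 0%E.
Local Notation D := (`[0%R, 1%R]%classic : set R).
Local Notation I := (Rintegral mu D).
Local Notation CI := (cintegral mu D).
Local Notation itg g := (mu.-integrable D (EFin \o (g : R -> R))).
Local Notation f0 := (bernstein mu).
Local Notation F0 := (mellin mu).
Hypothesis hm : forall n : nat,
  (\int[mu]_(t in `[0%R, 1%R]) (t ^+ n)%:E = (m n)%:E)%E.
Hypothesis m0 : m 0%N = 1.
Hypothesis m_gt0 : forall n, 0 < m n.
Hypothesis mrec : forall n, (0 < n)%N -> (1 + \sum_(1 <= k < n.+1) m k) * m n = 1.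
Implicit Types (p : {poly R}) (s t : R).

Lemma moment_sum n : (\sum_(j < n.+1) m j) * m n = 1.
Proof.
case: n => [|n]; first by rewrite big_ord1 m0 mulr1.
by rewrite -(big_mkord xpredT m) big_nat_recl// m0 -[RHS](@mrec n.+1)// big_add1.
Qed.

(** The [mu]-integral of [avg p s] in its second variable: [moment_sum] replaces $m_0 + \cdots +
    m_i$ by $1/m_i$. A second integration, in [s], cancels $m_i$. *)
Definition avg_int p s := \sum_(i < size p) p`_i / i.+1%:R / m i * s ^+ i.

Lemma integrable01_geometric i : itg (fun t => \sum_(j < i) t ^+ j).
Proof. by apply: (integrable01_sum muC i (g := fun j t => t ^+ j)) => j; exact: integrable01_exprn. Qed.

Lemma integrable01_avg p s : itg (avg p s).
Proof.
apply: (integrable01_sum muC (size p)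
  (g := fun i t => p`_i / i.+1%:R * s ^+ i * \sum_(j < i.+1) t ^+ j)) => i.
apply: integrable01Z; exact: integrable01_geometric.
Qed.

Lemma Rintegral01_avg p s : I (avg p s) = avg_int p s.
Proof.
rewrite (Rintegral01_sum muC (size p) (g := fun i t => p`_i / i.+1%:R * s ^+ i * \sum_(j < i.+1) t ^+ j)); last first.
  by move=> i; apply: integrable01Z; exact: integrable01_geometric.
apply: eq_bigr => i _; rewrite Rintegral01Z; last exact: integrable01_geometric.
rewrite (Rintegral01_sum muC _ (g := fun j t => t ^+ j)); last by move=> j; exact: integrable01_exprn.
under eq_bigr do rewrite (Rintegral01_exprn hm).
have := moment_sum i => E.
have -> : \sum_(j < i.+1) m j = (m i)^-1.
  by apply: (@mulIf _ (m i)); rewrite ?gt_eqF// E mulVf// gt_eqF.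
by rewrite mulrAC.
Qed.

Lemma integrable01_avg_int p : itg (avg_int p).
Proof. 
apply: (integrable01_sum muC (size p) (g := fun i s => p`_i / i.+1%:R / m i * s ^+ i)) => i.
by apply: integrable01Z; exact: integrable01_exprn.
 Qed.

Lemma Rintegral01_avg_int p : I (avg_int p) = avg p 1 0.
Proof.
rewrite (Rintegral01_sum muC (size p) (g := fun i s => p`_i / i.+1%:R / m i * s ^+ i)); last first.
  by move=> i; apply: integrable01Z; exact: integrable01_exprn.
apply: eq_bigr => i _; rewrite Rintegral01Z; last exact: integrable01_exprn.
rewrite (Rintegral01_exprn hm) divfK ?gt_eqF// expr1n mulr1 big_ord_recl expr0 big1 ?addr0 ?mulr1//.
by move=> j _; rewrite expr0n.
Qed.

(* [avg p 1 0] is the integral of [p] over [[0, 1]]; by [moment_sum] it is also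
   the double [mu]-integral of [avg p]. *)
Lemma avg_close_product p e (a : R[i]) (u v : R -> R[i]) :
  cintegrable01 mu u -> cintegrable01 mu v ->
  (forall s t, 0 <= s <= 1 -> 0 <= t <= 1 ->
    `|avg p s t - complex.Re (a * u s * v t)| <= e) ->
  `|avg p 1 0 - complex.Re (a * CI u * CI v)| <= e.
Proof.
move=> iu iv H.
have Hs s : 0 <= s <= 1 -> `|avg_int p s - complex.Re (a * u s * CI v)| <= e.
  move=> s01; have [c1 _] := cintegrable01Z (a * u s) iv.
  rewrite -Rintegral01_avg -cintegral01Z// -[complex.Re _]/(I (fun t => complex.Re (a * u s * v t))).
  rewrite -Rintegral01B//; last exact: integrable01_avg.
  by apply: (normr_Rintegral01_le muC); [apply: integrable01B => //; exact: integrable01_avg|move=> t; exact: H].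
have [c1 _] := cintegrable01Z (a * CI v) iu.
rewrite -Rintegral01_avg_int mulrAC -cintegral01Z//.
rewrite -[complex.Re _]/(I (fun s => complex.Re (a * CI v * u s))).
rewrite -Rintegral01B//; last exact: integrable01_avg_int.
apply: (normr_Rintegral01_le muC); first by apply: integrable01B => //; exact: integrable01_avg_int.
by move=> s /Hs; rewrite mulrAC.
Qed.

(* [s^z (1-t^(z+1))/(1-t)] is [z+1] times the average of [u^z] over [[st, s]]. *)
Lemma avg_cpow (a z : R[i]) p e : 0 < complex.Re z ->
  (forall x, 0 <= x <= 1 -> `|p.[x] - complex.Re (a * cpow x z)| <= e) ->
  forall s t, 0 <= s <= 1 -> 0 <= t <= 1 ->
    `|avg p s t - complex.Re (a / (z + 1) * cpow s z * bkern (z + 1) t)| <= e.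
Proof.
move=> z0 Hp s t /andP[s0 s1] /andP[t0 t1].
have z1 : z + 1 != 0.
  by apply/eqP => /(congr1 (@complex.Re R)); rewrite ReD/= => ?; lra.
move: s0; rewrite le_eqVlt => /predU1P[<-|s0].
  by have := Hp 0; rewrite lexx ler01 avg0 cpow0 !mulr0 mul0r; apply.
have [->|tn1] := eqVneq t 1.
  rewrite avg1 bkern1 mulrAC divfK//; apply: Hp; by rewrite (ltW s0).
have t1' : t < 1 by rewrite lt_neqAle tn1.
pose H x := complex.Re (a / (z + 1) * cpow x (z + 1)).
have z10 : 0 < complex.Re (z + 1) by rewrite ReD/=; lra.
have dH (x : R) : 0 < x < 1 -> is_derive (x : R) (1 : R) H (complex.Re (a * cpow x z)).
  move=> /andP[x0 _]; apply: is_derive_eq (is_derive_Re_cpow _ _ x0) _.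
  rewrite divfK// cpowD -[1]/(1%:R) (cpow_nat _ x0) expr1 mulrA ReM/= mulr0 subr0.
  by rewrite mulfK// gt_eqF.
have := @avg_close _ p H _ e s t _ _ dH _ Hp; rewrite s0 s1 t0 t1' => /(_ isT isT).
have cH : forall x : R, 0 <= x <= 1 -> {for x, continuous H}.
  by move=> x _; exact: continuous_Re_cpow.
move=> /(_ cH); congr (`|_ - _| <= _).
rewrite /H -ReN -ReD cpowM// /bkern (negbTE tn1) cpowD -[1]/(1%:R) (cpow_nat _ s0) expr1 -/(1%R).
rewrite (_ : _ - _ = (s * (1 - t))%:C * (a / (z + 1) * cpow s z * ((1 - cpow t (z + 1)) / (1 - t)%:C))).
  by rewrite Re_realM mulrC mulKf// mulf_neq0 ?gt_eqF// subr_gt0.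
rewrite rmorphM/=; field.
rewrite z1 /= andbT; apply/eqP => /(congr1 (@complex.Re R)).
by rewrite ReD ReN/= => /eqP; rewrite subr_eq0 eq_sym (negbTE tn1).
Qed.

(** Let [p] approximate $\Re(a u^z)$. Then [avg p 1 0] is close to $\Re(a w/(z+1))$ by double
    integration and to $\Re(a/(z+1))$ by direct evaluation, so the two agree for every $a$. *)
Theorem bernstein_mellin z : 0 < complex.Re z -> f0 (z + 1) * F0 z = 1.
Proof.
move=> z0; set w := f0 (z + 1) * F0 z.
have z1 : z + 1 != 0.
  by apply/eqP => /(congr1 (@complex.Re R)); rewrite ReD/= => ?; lra.
have key (a : R[i]) : complex.Re (a / (z + 1) * (w - 1)) = 0.
  apply/eqP; rewrite -normr_le0; apply/ler_addgt0Pl => e e0; rewrite addr0.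
  have e20 : 0 < e / 2 by rewrite divr_gt0.
  have [p Hp] := weierstrass e20 (fun x _ => continuous_Re_cpow (w := a) (u := x) z0).
  have H := avg_cpow z0 Hp.
  have iv : cintegrable01 mu (bkern (z + 1)) by apply: cintegrable01_bkern => //; rewrite ReD/=; lra.
  have := avg_close_product (cintegrable01_cpow muC (ltW z0)) iv H.
  rewrite -/(mellin mu z) -/(bernstein mu (z + 1)) -mulrA (mulrC (F0 z)) -/w => h1.
  (* At $s = 1$, $t = 0$ both [cpow] and [bkern] equal 1. *)
  have := H 1 0; rewrite ler01 !lexx => /(_ isT isT).
  rewrite cpow1 bkern0 !mulr1 => h2.
  rewrite mulrBr mulr1 ReD ReN.
  rewrite (_ : complex.Re _ - _ = (avg p 1 0 - complex.Re (a / (z + 1))) -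
     (avg p 1 0 - complex.Re (a / (z + 1) * w))); last by ring.
  rewrite (le_trans (ler_normB _ _))//; lra.
apply/eqP; rewrite -subr_eq0; apply/eqP; apply: complex_ext.
  (* The weights $z + 1$ and $-i(z + 1)$ extract the real and the imaginary part of $w - 1$. *)
  by have := key (z + 1); rewrite divff// mul1r.
by have := key (- 'i * (z + 1)); rewrite mulfK// ReM/= oppr0 mul0r sub0r mulN1r opprK.
Qed.

End MomentIdentity.

(** * Convergence of the integral of $t^x$ for $x > -1$, and divergence at $x = -1$ *)

Section Singularity.
Variables (R : realType) (mu : probability R R) (m : nat -> R).
Hypothesis muC : mu (~` `[0%R, 1%R]) = 0%E.
Local Notation D := (`[0%R, 1%R]%classic : set R).
Local Notation I := (Rintegral mu D).
Local Notation itg g := (mu.-integrable D (EFin \o (g : R -> R))).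
Hypothesis hm : forall n : nat,
  (\int[mu]_(t in `[0%R, 1%R]) (t ^+ n)%:E = (m n)%:E)%E.
Hypothesis m0 : m 0%N = 1.
Hypothesis m_gt0 : forall n, 0 < m n.
Hypothesis mrec : forall n, (0 < n)%N -> (1 + \sum_(1 <= k < n.+1) m k) * m n = 1.
Implicit Types (p : {poly R}) (s t x c : R) (g h : R -> R).

Lemma is_derive_rpow x t : 0 < t ->
  is_derive (t : R) (1 : R) (fun v : R => rpow v x) (x * rpow t (x - 1)).
Proof.
move=> t0; have E : (fun v : R => rpow v x) = (fun v => complex.Re (1 * cpow v x%:C%C)).
  apply/funext => v; rewrite mul1r /rpow /cpow; case: ifP => //= _.
  by rewrite mul0r cos0 mulr1.
rewrite E; apply: is_derive_eq (is_derive_Re_cpow _ _ t0) _.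
rewrite mul1r Re_realM -mulrA; congr (_ * _).
rewrite /cpow /rpow t0 /= mul0r cos0 mulr1 mulrBl mul1r expRB.
by rewrite lnK.
Qed.

Lemma rpow_le_base x s t : x <= 0 -> 0 < s -> s <= t -> rpow t x <= rpow s x.
Proof.
move=> x0 s0 st; have t0 := lt_le_trans s0 st.
by rewrite /rpow s0 t0 ler_expR ler_wnM2l// ler_ln ?posrE.
Qed.

(** The bound is integrated in [t], then in [s]; its left side is independent of [t], and [mu] has
    mass 1. *)
Lemma le_avg10 p h c : itg h ->
  (forall s t, 0 <= s <= 1 -> 0 <= t <= 1 -> h s - c <= avg p s t) ->
  I h - c <= avg p 1 0.
Proof.
move=> ih H; have ic := integrable01_cst muC c.
rewrite -(Rintegral01_avg_int muC hm m_gt0) -[X in _ - X](Rintegral01_cst muC) -Rintegral01B//.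
apply: le_Rintegral01; [exact: integrable01B|exact: integrable01_avg_int|].
move=> s s01; rewrite -(Rintegral01_avg muC hm m0 m_gt0 mrec) -[leLHS](Rintegral01_cst muC).
by apply: le_Rintegral01; [exact: integrable01_cst|exact: integrable01_avg|move=> t t01; exact: H].
Qed.

Lemma measurable_rpow x : measurable_fun setT (fun t : R => rpow t x).
Proof.
rewrite /rpow; apply: measurable_fun_ifT => //; first exact: measurable_fun_ltr.
apply: measurableT_comp => //.
by apply: measurable_funM => //; exact: measurable_ln.
Qed.

Lemma integrable01_rpow_shift x c : x <= 0 -> 0 < c -> itg (fun s => rpow (s + c) x).
Proof.
move=> x0 c0; apply: (bounded_integrable01 muC (C := rpow c x)).
  apply: (measurableT_comp (measurable_rpow x)); exact: measurable_funD.
move=> t /andP[t0 t1]; rewrite ger0_norm ?rpow_ge0// rpow_le_base// lerDr//.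
Qed.

(* Decreasing functions have a smaller integral against [mu] than against the
   Lebesgue measure, because they are below their averages over [[st, s]]. *)
Lemma Rintegral01_rpow_shift_le x c : -1 < x < 0 -> 0 < c <= 1 ->
  I (fun s => rpow (s + c) x) <= 2 / (x + 1) + 2.
Proof.
move=> /andP[x1 x0] /andP[c0 c1]; have x10 : 0 < x + 1 by lra.
have dsh y (u : R) : 0 <= u <= 1 ->
    is_derive (u : R) (1 : R) (fun v : R => rpow (v + c) y) (y * rpow (u + c) (y - 1)).
  move=> /andP[u0 _]; have uc : 0 < u + c by lra.
  have := @is_derive1_comp R (fun v => rpow v y) (shift c) u _ _ (is_derive_rpow y uc) (is_derive_shift u 1 c).
  by rewrite mulr1.
have ch y (u : R) : 0 <= u <= 1 -> {for u, continuous (fun v : R => rpow (v + c) y)}.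
  by move=> /(dsh y) [+ _]; move=> /derivable1_diffP/differentiable_continuous.
(* An error of 1 suffices for a bound; it enters once from below and once from above, which gives
   the final [+ 2]. *)
have [p Hp] := weierstrass ltr01 (ch x).
have low : I (fun s => rpow (s + c) x) - 1 <= avg p 1 0.
  apply: le_avg10; first by apply: integrable01_rpow_shift => //; exact: ltW.
  move=> s t /andP[s0 s1] t01; have [u /andP[u1 u2] ->] := avg_mvt p s0 t01.
  have u0 : 0 <= u by rewrite (le_trans _ u1)// mulr_ge0//; case/andP: t01.
  have := Hp u; rewrite u0 (le_trans u2 s1) => /(_ isT); rewrite ler_norml => /andP[h1 _].
  have : rpow (s + c) x <= rpow (u + c) x.
    by rewrite rpow_le_base ?lerD2r ?(ltW x0)// ltr_wpDl.
  lra.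
pose H := (x + 1)^-1 *: (fun v : R => rpow (v + c) (x + 1)).
have dH (u : R) : 0 < u < 1 -> is_derive (u : R) (1 : R) H (rpow (u + c) x).
  move=> /andP[u0 u1]; apply: is_derive_eq (is_deriveZ _ (dsh (x + 1) u _)) _.
    by rewrite !ltW.
  by rewrite /GRing.scale/= addrK mulKf// gt_eqF.
have cH (u : R) : 0 <= u <= 1 -> {for u, continuous H}.
  move=> u01; apply: continuousZr; exact: ch.
have := avg_close (p := p) (s := 1) (t := 0) _ _ dH cH Hp.
have -> : (H 1 - H (1 * 0)) / (1 * (1 - 0)) = H 1 - H 0.
  by rewrite mulr0 subr0 mul1r divr1.
rewrite ltr01 !lexx => /(_ isT isT) hA.
have H0 : 0 <= H 0 by rewrite /H mulr_ge0 ?rpow_ge0// invr_ge0 ltW.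
(* Here $(1 + c)^{x+1} \le 1 + c \le 2$, as $0 < x + 1 < 1$. *)
have H1 : H 1 <= 2 / (x + 1).
  rewrite [leLHS]mulrC ler_pM2r ?invr_gt0// /rpow ltr_pwDl//; last by rewrite ltW.
  have l0 : 0 <= ln (1 + c) by rewrite ln_ge0// lerDl ltW.
  rewrite (@le_trans _ _ (expR (ln (1 + c))))//; first by rewrite ler_expR; nra.
  by rewrite lnK ?posrE; lra.
move: hA; rewrite ler_norml => /andP[_]; lra.
Qed.

(** For negative [x] the shifted powers $(t + 1/(n+1))^x$ increase to $t^x$, and their integrals are
    bounded independently of the shift; monotone convergence concludes. *)
Lemma mellin_rpow_lty x : -1 < x ->
  (\int[mu]_(t in `[0%R, 1%R]) (rpow t x)%:E < +oo)%E.
Proof.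
move=> x1; have [x0|x0] := leP 0 x.
  apply: integrable_lty => //; apply: (bounded_integrable01 muC (C := 1)); first exact: measurable_rpow.
  by move=> t t01; rewrite ger0_norm ?rpow_ge0// rpow_le1.
(* The cut at 0 gives the limit the value [rpow 0 x = 0]. *)
pose g n t := (if 0 < t then rpow (t + n.+1%:R^-1) x else 0)%:E.
have c0 n : 0 < n.+1%:R^-1 :> R by rewrite invr_gt0.
have c1 n : n.+1%:R^-1 <= 1 :> R by rewrite invf_le1// ler1n.
have mg n : measurable_fun D (g n).
  apply/measurable_EFinP; apply: measurable_funTS; apply: measurable_fun_ifT => //.
    exact: measurable_fun_ltr.
  apply: (measurableT_comp (measurable_rpow x)); exact: measurable_funD.
have g0 n t : D t -> (0 <= g n t)%E.
  by move=> _; rewrite lee_fin; case: ifP => // _; exact: rpow_ge0.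
have ndg t : D t -> nondecreasing_seq (g ^~ t).
  move=> _ i j ij; rewrite lee_fin; case: ifP => // t0.
  apply: rpow_le_base; [exact: ltW|exact: addr_gt0|].
  by rewrite lerD2l lef_pV2 ?posrE// ler_nat.
have gl t : limn (g ^~ t) = (rpow t x)%:E.
  suff H : (fun n => if 0 < t then rpow (t + n.+1%:R^-1) x else 0 : R) @ \oo --> rpow t x.
    by apply: cvg_lim => //; apply: cvg_EFin => //; exact: nearW.
  have [t0|t0] := ltP 0 t; last by rewrite /rpow ltNge t0; exact: cvg_cst.
  have [+ _] := is_derive_rpow x t0.
  move=> /derivable1_diffP/differentiable_continuous ct.
  have ch : (fun n => t + n.+1%:R^-1 : R) @ \oo --> t.
    by rewrite -[X in _ --> X]addr0; apply: cvgD; [exact: cvg_cst|exact: cvg_harmonic].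
  exact: (cvg_comp (fun n => t + n.+1%:R^-1) (fun v : R => rpow v x) ch ct).
under eq_integral do rewrite -gl.
rewrite monotone_convergence//.
apply: (@le_lt_trans _ _ (2 / (x + 1) + 2)%:E); last exact: ltry.
apply: lime_le.
  apply: ereal_nondecreasing_is_cvgn => i j ij; apply: ge0_le_integral => // t Dt; [exact: g0|exact: ndg].
apply: nearW => n; have ix := integrable01_rpow_shift (ltW x0) (c0 n).
have := @Rintegral01_rpow_shift_le x n.+1%:R^-1; rewrite x1 x0 c0 c1 => /(_ isT isT).
rewrite -lee_fin; apply: le_trans.
rewrite /Rintegral fineK; last exact: integrable_fin_num.
apply: ge0_le_integral => //.
- by move=> t Dt; exact: g0.
- by case/integrableP: ix.
by move=> t _; rewrite lee_fin; case: ifP => // _; exact: rpow_ge0.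
Qed.

(** This is [avg_close] with error 0. *)
Lemma avg10_deriv p q : deriv q = p -> avg p 1 0 = q.[1] - q.[0].
Proof.
move=> dq; apply/eqP; rewrite -subr_eq0 -normr_le0.
have := @avg_close _ p (horner q) (horner p) 0 1 0.
have -> : (q.[1] - q.[1 * 0]) / (1 * (1 - 0)) = q.[1] - q.[0].
  by rewrite mulr0 subr0 mul1r divr1.
apply.
- by rewrite ltr01 lexx.
- by rewrite lexx ltr01.
- by move=> x _; rewrite -dq; exact: is_derive_poly.
- by move=> x _; exact: continuous_horner.
- by move=> x _; rewrite subrr normr0.
Qed.

Definition onem_pow k : {poly R} := (1 - 'X) ^+ k.

Lemma horner_onem_pow k t : (onem_pow k).[t] = (1 - t) ^+ k.
Proof. by rewrite /onem_pow horner_exp !hornerE. Qed.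

Definition onem_pow_primitive k : {poly R} := (- k.+1%:R^-1) *: onem_pow k.+1.

Lemma deriv_onem_pow_primitive k : deriv (onem_pow_primitive k) = onem_pow k.
Proof.
rewrite /onem_pow_primitive /onem_pow derivZ deriv_exp/= derivB derivX derivC.
rewrite -[X in _ *: X]scaler_nat scalerA mulNr mulVf ?pnatr_eq0//.
by rewrite scaleN1r sub0r mulN1r opprK.
Qed.

Lemma onem_pow_primitive_diff k :
  (onem_pow_primitive k).[1] - (onem_pow_primitive k).[0] = k.+1%:R^-1.
Proof.
rewrite /onem_pow_primitive !hornerZ !horner_onem_pow subrr subr0 expr0n expr1n.
by rewrite mulr0 mulr1 sub0r opprK.
Qed.

(** Since [0^-1 = 0], the bound by [s^-1 * t^-1] breaks down when [s] or [t] is 0; multiples of this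
    indicator repair it. *)
Definition at0 t : R := if t == 0 then 1 else 0.

Lemma integrable01_at0 : itg at0.
Proof.
apply: (bounded_integrable01 muC (C := 1)).
  by apply: measurable_fun_ifT => //; exact: measurable_fun_eqr.
by move=> t _; rewrite /at0; case: ifP; rewrite ?normr1// normr0.
Qed.

(** The point 0 carries no mass: the indicator at [s] is below every average of $(1-u)^k$ over
    $[st, s]$, so its integral is at most $1/(k+1)$. *)
Lemma Rintegral01_at0 : I at0 = 0.
Proof.
apply/eqP; rewrite eq_le; apply/andP; split; last first.
  by apply: Rintegral_ge0 => t _; rewrite /at0; case: ifP.
apply/ler_addgt0Pl => e e0; rewrite addr0.
pose k := Num.bound e^-1.
have ke : k.+1%:R^-1 <= e.
  rewrite -[leRHS]invrK lef_pV2 ?posrE ?invr_gt0// ltW//.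
  rewrite (lt_le_trans (archi_boundP _)) ?ler_nat// ?invr_ge0 ltW//.
rewrite (le_trans _ ke)// -onem_pow_primitive_diff -(avg10_deriv (deriv_onem_pow_primitive k)).
rewrite -[leLHS]subr0; apply: le_avg10; first exact: integrable01_at0.
move=> s t /andP[s0 s1] t01; have [u /andP[u1 u2] ->] := avg_mvt (onem_pow k) s0 t01.
have u0 : 0 <= u by rewrite (le_trans _ u1)// mulr_ge0//; case/andP: t01.
rewrite horner_onem_pow subr0 /at0; case: eqP => [sn0|_].
  by rewrite (_ : u = 0) ?subr0 ?expr1n//; apply/eqP; rewrite eq_le u0 andbT -sn0.
by rewrite exprn_ge0// subr_ge0 (le_trans u2).
Qed.

(** For positive [s] and [t] the geometric sum is at most $1/u \le 1/(st)$, as $u \ge st$. If [s] or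
    [t] is 0, the trivial bound [n] is covered by an indicator. *)
Lemma avg_geometric_le n s t : 0 <= s <= 1 -> 0 <= t <= 1 ->
  avg (\sum_(k < n) onem_pow k) s t <= s^-1 * t^-1 + n%:R * at0 s + n%:R * at0 t.
Proof.
move=> /andP[s0 s1] t01; have /andP[t0 t1] := t01.
have [u /andP[u1 u2] ->] := avg_mvt (\sum_(k < n) onem_pow k) s0 t01.
have u0 : 0 <= u by rewrite (le_trans _ u1)// mulr_ge0.
have v0 : 0 <= 1 - u by rewrite subr_ge0 (le_trans u2).
have v1 : 1 - u <= 1 by rewrite gerBl.
rewrite horner_sum; under eq_bigr do rewrite horner_onem_pow.
have Sn : \sum_(k < n) (1 - u) ^+ k <= n%:R.
  have -> : n%:R = \sum_(k < n) 1 :> R by rewrite sumr_const card_ord.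
  by apply: ler_sum => k _; exact: exprn_ile1.
have st0 : 0 <= s^-1 * t^-1 by rewrite mulr_ge0 ?invr_ge0.
rewrite /at0; case: eqP => [_|/eqP sn0].
  case: eqP => _; rewrite ?mulr1 ?mulr0; have := ler0n R n; lra.
case: eqP => [_|/eqP tn0]; first by rewrite mulr0 mulr1; lra.
rewrite !mulr0 !addr0.
have st : 0 < s * t by rewrite mulr_gt0 // lt_neqAle eq_sym ?sn0 ?tn0.
have up : 0 < u by exact: lt_le_trans u1.
rewrite (@le_trans _ _ u^-1)//; last by rewrite -invfM lef_pV2.
rewrite -[leRHS]mulr1 ler_pdivlMl//.
have := subrX1 (1 - u) n; have := exprn_ge0 n v0; move: (\sum_(_ < _) _) => S a b.
have -> : u * S = 1 - (1 - u) ^+ n by rewrite -[RHS]opprB b; ring.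
lra.
Qed.

(** A finite value [C] would bound every harmonic sum by $C^2$. With [0^-1 = 0] the point 0
    contributes nothing, so the divergence comes from positive [t]. *)
Lemma mellin_inv_infty : (\int[mu]_(t in `[0%R, 1%R]) (t^-1)%:E = +oo)%E.
Proof.
apply/eqP; apply/negPn/negP => Hoo.
have mV : measurable_fun setT (fun t : R => t^-1) by apply: measurable_funV.
have ig : itg (fun t => t^-1).
  apply/integrableP; split; first by apply/measurable_EFinP; exact: measurable_funTS.
  rewrite (@eq_integral _ _ _ _ _ (fun t : R => (t^-1)%:E)); first by rewrite ltey.
  by move=> t; rewrite inE/= in_itv/= => /andP[t0 _]; rewrite ger0_norm// invr_ge0.
set C := I (fun t => t^-1).
have key n : \sum_(k < n) k.+1%:R^-1 <= C * C.
  have -> : \sum_(k < n) k.+1%:R^-1 = avg (\sum_(k < n) onem_pow k) 1 0.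
    rewrite (@avg10_deriv _ (\sum_(k < n) onem_pow_primitive k)).
      rewrite !horner_sum -sumrB; apply: eq_bigr => k _; exact/esym/onem_pow_primitive_diff.
    by rewrite raddf_sum/=; apply: eq_bigr => k _; exact: deriv_onem_pow_primitive.
  set p := \sum_(k < n) _; have iz := integrable01Z n%:R integrable01_at0.
  have inner_le s : 0 <= s <= 1 -> avg_int m p s <= C * s^-1 + n%:R * at0 s.
    move=> s01; have ic := integrable01_cst muC (n%:R * at0 s).
    have e : C * s^-1 + n%:R * at0 s =
        I (fun t => s^-1 * t^-1 + cst (n%:R * at0 s) t + n%:R * at0 t).
      rewrite Rintegral01D//; last by apply: integrable01D => //; exact: integrable01Z.
      rewrite Rintegral01D//; last exact: integrable01Z.
      rewrite (Rintegral01_cst muC) !Rintegral01Z//; last exact: integrable01_at0.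
      by rewrite Rintegral01_at0 mulr0 addr0 mulrC.
    rewrite e -(Rintegral01_avg muC hm m0 m_gt0 mrec); apply: le_Rintegral01.
    - exact: integrable01_avg.
    - by do 2! apply: integrable01D => //; exact: integrable01Z.
    - by move=> t t01; exact: avg_geometric_le.
  have e : C * C = I (fun s => C * s^-1 + n%:R * at0 s).
    rewrite Rintegral01D//; last exact: integrable01Z.
    by rewrite !Rintegral01Z//; [rewrite Rintegral01_at0 mulr0 addr0|exact: integrable01_at0].
  rewrite e -(Rintegral01_avg_int muC hm m_gt0); apply: le_Rintegral01 => //; first exact: integrable01_avg_int.
  by apply: integrable01D => //; exact: integrable01Z.
apply: (@dvg_harmonic R); apply: nondecreasing_is_cvgn.
  by apply/nondecreasing_seqP => n; rewrite /series/= big_nat_recr//= lerDl invr_ge0.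
by exists (C * C) => _ [n _ <-]; rewrite /series/= big_mkord.
Qed.

End Singularity.

(** * Nonreal values of $f$ off the real line *)

Section ImaginaryPart.
Variables (R : realType) (mu : probability R R) (m : nat -> R).
Local Open Scope complex_scope.
Hypothesis muC : mu (~` `[0%R, 1%R]) = 0%E.
Local Notation D := (`[0%R, 1%R]%classic : set R).
Local Notation I := (Rintegral mu D).
Local Notation f0 := (bernstein mu).
Local Notation F0 := (mellin mu).
Hypothesis hm : forall n : nat,
  (\int[mu]_(t in `[0%R, 1%R]) (t ^+ n)%:E = (m n)%:E)%E.
Hypothesis m0 : m 0%N = 1.
Hypothesis m_gt0 : forall n, 0 < m n.
Hypothesis mrec : forall n, (0 < n)%N -> (1 + \sum_(1 <= k < n.+1) m k) * m n = 1.
Implicit Types (z w : R[i]) (t q x y : R).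

Lemma sin_ge_mul_cos1 y : 0 <= y <= 1 -> y * cos 1 <= sin y.
Proof.
move=> /andP[y0 y1].
have [c] := @MVT_segment R sin cos 0 y y0 (fun x _ => is_derive_sin x)
  (continuous_subspaceT (@continuous_sin R)).
rewrite sin0 !subr0 in_itv/= => /andP[c0 cy] ->.
rewrite mulrC ler_wpM2r//; have [->//|c1] := eqVneq c 1.
have pi1 : (1 : R) <= pi by have := @pi_ge2 R; lra.
rewrite ltW// ltr_cos ?in_itv/= ?ler01 ?pi1 ?c0 ?(le_trans cy (le_trans y1 pi1))//.
by rewrite lt_neqAle c1 (le_trans cy).
Qed.

Lemma exprn_small q (e : R) : 0 <= q < 1 -> 0 < e -> exists n, q ^+ n < e.
Proof.
move=> /andP[q0 q1] e0.
have := @cvg_expr R q; rewrite ger0_norm// => /(_ q1) /cvgrPdist_lt /(_ _ e0) [n _ Hn].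
exists n; have := Hn n (leqnn n); rewrite /= sub0r normrN ger0_norm// exprn_ge0//.
Qed.

(** If $m_k \le q^k$ for all $k$, the sums of moments stay below $1/(1-q)$, and the recursion forces
    $m_n \ge 1 - q$ for all $n$, against $q^n \to 0$. *)
Lemma moment_not_geometric q : 0 < q < 1 -> exists k, q ^+ k < m k.
Proof.
move=> /andP[q0 q1]; apply: contrapT => H.
have mq k : m k <= q ^+ k by rewrite leNgt; apply/negP => h; apply: H; exists k.
have q1' : 0 < 1 - q by lra.
have [n qn] : exists n, q ^+ n < 1 - q by apply: exprn_small => //; rewrite ltW.
have := moment_sum m0 mrec n; have := mq n; have := m_gt0 n.
have : \sum_(j < n.+1) m j <= (1 - q)^-1.
  apply: (@le_trans _ _ (\sum_(j < n.+1) q ^+ j)); first exact: ler_sum.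
  rewrite -[leRHS]mul1r ler_pdivlMr//.
  have := subrX1 q n.+1; have := exprn_ge0 n.+1 (ltW q0).
  by move: (\sum_(_ < _) _) => S a b; lra.
move: (\sum_(_ < _) _) => S; rewrite -[X in _ <= X]mul1r ler_pdivlMr// => h1 h2 h3 h4.
have : S * (1 - q) * m n <= m n by rewrite ler_piMl// ltW.
rewrite mulrAC h4; lra.
Qed.

(** The second factor is positive, so $w - 1/w$ has an imaginary part of the same sign as $w$, and
    is real only if $w$ is. *)
Lemma Im_subV w : complex.Im (w - w^-1) = complex.Im w * (1 + (cmod w) ^- 2).
Proof.
rewrite ImD ImN mulrDr mulr1; congr (_ + _).
rewrite /cmod sqr_sqrtr ?addr_ge0 ?sqr_ge0//.
by case: w => a b /=; rewrite opprK.
Qed.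

(* The contribution of [t] near [1], where the sine is positive, decays like
   [q^n], while the region where the sine may be negative contributes at most
   [q^(2n)]. *)
Lemma Im_bkern_lower z n k t : 0 < complex.Re z -> complex.Im z != 0 -> 0 <= t <= 1 ->
  forall q, q = expR (- `|complex.Im z|^-1) ->
  q ^+ n * (rpow q (complex.Re z) * `|complex.Im z| * cos 1) * (t ^+ k - q ^+ k) -
    q ^+ n * q ^+ n / (1 - q ^+ 2) <=
  Num.sg (complex.Im z) * complex.Im (bkern (z + n%:R) t).
Proof.
move=> x0 y0 /andP[t0 t1] q qE; set x := complex.Re z; set Y := `|complex.Im z|.
have Y0 : 0 < Y by rewrite normr_gt0.
have q0 : 0 < q by rewrite qE expR_gt0.
have q1 : q < 1 by rewrite qE expR_lt1 oppr_lt0 invr_gt0.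
have qn0 : 0 < q ^+ n by exact: exprn_gt0.
have qn1 : q ^+ n <= 1 by rewrite exprn_ile1 ?ltW.
have q21 : 0 < 1 - q ^+ 2 by rewrite subr_gt0 expr_lt1// ltW.
have C0 : 0 <= q ^+ n * q ^+ n / (1 - q ^+ 2).
  by rewrite divr_ge0 ?mulr_ge0 ?ltW.
have c1 : 0 < cos 1 :> R by exact: cos1_gt0.
have rq0 : 0 <= rpow q x by exact: rpow_ge0.
have rq1 : rpow q x <= 1 by rewrite rpow_le1 ?(ltW q0) ?(ltW q1) ?(ltW x0).
set c0 := rpow q x * Y * cos 1.
have c00 : 0 <= c0 by rewrite !mulr_ge0 ?(ltW Y0) ?(ltW c1).
have tq1 : t ^+ k - q ^+ k <= 1.
  have := exprn_ge0 k (ltW q0); have := exprn_ile1 k t0 t1; lra.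
have up : q ^+ n * c0 * (t ^+ k - q ^+ k) <= q ^+ n * c0.
  by rewrite ler_piMr// mulr_ge0// ltW.
have low : t <= q -> q ^+ n * c0 * (t ^+ k - q ^+ k) <= 0.
  move=> tq; apply: mulr_ge0_le0; first by apply: mulr_ge0 => //; exact: ltW.
  by rewrite subr_le0 lerXn2r ?nnegrE// ltW.
have -> : complex.Im (bkern (z + n%:R) t) =
    if t == 1 then complex.Im z
    else - complex.Im (cpow t (z + n%:R)) / (1 - t).
  rewrite /bkern; case: eqP => _; first by rewrite ImD Im_nat addr0.
  by rewrite -fmorphV ImM/= mulr0 add0r ImD ImN add0r.
have [_|tn1] := eqVneq t 1.
  rewrite -normrEsg -/Y.
  have h1 : rpow q x * Y <= Y by rewrite ler_piMl// ltW.
  have h2 : c0 <= rpow q x * Y.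
    by rewrite ler_piMr ?cos_le1// mulr_ge0// ltW.
  have h3 : q ^+ n * c0 <= c0 by rewrite ler_piMl.
  lra.
have t1' : 0 < 1 - t by rewrite subr_gt0 lt_neqAle tn1.
move: t0; rewrite le_eqVlt => /predU1P[t0|t0].
  have tq : t <= q by rewrite -t0 ltW.
  have -> : cpow t (z + n%:R) = 0 by rewrite -t0 cpow0.
  by rewrite /= oppr0 mul0r mulr0; have := low tq; lra.
have -> : Num.sg (complex.Im z) * (- complex.Im (cpow t (z + n%:R)) / (1 - t)) =
    rpow t x * t ^+ n * sin (Y * - ln t) / (1 - t).
  rewrite mulrA; congr (_ / _); rewrite /cpow t0 ReD ImD Re_nat Im_nat addr0/= -/x.
  rewrite /rpow t0 mulrDl expRD expRM_natl lnK ?posrE//.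
  have -> : sin (Y * - ln t) = - (Num.sg (complex.Im z) * sin (complex.Im z * ln t)).
    by rewrite mulrN sinN /Y normrEsg -mulrA sin_sg.
  by ring.
have L0 : 0 <= - ln t by rewrite Nln_ge0// t0.
have YL0 : 0 <= Y * - ln t by rewrite mulr_ge0// ltW.
have rt0 : 0 <= rpow t x by exact: rpow_ge0.
have tn0 : 0 <= t ^+ n by rewrite exprn_ge0// ltW.
(* By the choice of [q], the argument of the sine is at most 1 on $[q, 1]$ and at most $2 \le \pi$
   on $[q^2, q]$. Only below $q^2$ can the sine be negative, and there $t^n \le q^{2n}$. *)
have [qt|tq] := leP q t.
  have YL1 : Y * - ln t <= 1.
    have : ln q <= ln t by rewrite ler_ln ?posrE.
    rewrite qE expRK -/Y => h; rewrite -ler_pdivlMl// mulr1; lra.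
  have s1 : Y * - ln t * cos 1 <= sin (Y * - ln t) by rewrite sin_ge_mul_cos1// YL0.
  have s2 : Y * cos 1 * (1 - t) <= sin (Y * - ln t).
    rewrite (le_trans _ s1)// mulrAC ler_wpM2r ?(ltW c1)// ler_wpM2l ?(ltW Y0)//.
    exact: ln_upper.
  have r1 : rpow q x * q ^+ n <= rpow t x * t ^+ n.
    rewrite ler_pM ?(ltW qn0)//; last by rewrite lerXn2r ?nnegrE// ltW.
    rewrite /rpow q0 t0 ler_expR ler_wpM2l ?(ltW x0)// ler_ln ?posrE//.
  rewrite lerBlDr (le_trans up)// ler_wpDr// ler_pdivlMr//.
  rewrite (_ : _ * (1 - t) = rpow q x * q ^+ n * (Y * cos 1 * (1 - t))); last by rewrite /c0; ring.
  by rewrite ler_pM// ?mulr_ge0// ?ltW.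
have low' := low (ltW tq).
have [q2t|tq2] := leP (q ^+ 2) t.
  have YL2 : Y * - ln t <= pi.
    have : ln (q ^+ 2) <= ln t by rewrite ler_ln ?posrE// exprn_gt0.
    rewrite lnXn// qE expRK -/Y => h.
    rewrite (le_trans _ (@pi_ge2 R))// -ler_pdivlMl//; lra.
  have s0 : 0 <= sin (Y * - ln t) by rewrite sin_ge0_pi// YL0.
  rewrite (@le_trans _ _ 0)//; first lra.
  by rewrite divr_ge0 ?mulr_ge0// ltW.
have G : - (rpow t x * t ^+ n * sin (Y * - ln t)) <= t ^+ n.
  rewrite (le_trans (ler_norm _))// normrN !normrM (ger0_norm rt0) (ger0_norm tn0).
  have r1 : rpow t x <= 1 by rewrite rpow_le1 ?(ltW t0) ?t1 ?ltW.
  rewrite (@le_trans _ _ (rpow t x * t ^+ n))//.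
    by rewrite ler_piMr ?mulr_ge0// sin_max.
  by rewrite ler_piMl.
suff h : t ^+ n / (1 - t) <= q ^+ n * q ^+ n / (1 - q ^+ 2).
  have : - (rpow t x * t ^+ n * sin (Y * - ln t)) / (1 - t) <= t ^+ n / (1 - t).
    by rewrite ler_wpM2r// invr_ge0 ltW.
  rewrite mulNr; lra.
rewrite -exprMn -expr2 ler_pM ?invr_ge0 ?(ltW t1')//.
  by rewrite lerXn2r ?nnegrE ?exprn_ge0 ?ltW.
by rewrite lef_pV2 ?posrE// lerD2l lerN2 ltW.
Qed.

Lemma bernstein_step z : 0 < complex.Re z ->
  f0 z = f0 (z + 1) - (f0 (z + 1))^-1.
Proof.
move=> z0; have E := bernstein_mellin muC hm m0 m_gt0 mrec z0.
have fn0 : f0 (z + 1) != 0.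
  by apply/eqP => f00; move: E; rewrite f00 mul0r => /esym/eqP; rewrite oner_eq0.
have -> : (f0 (z + 1))^-1 = F0 z by rewrite -[RHS](mulKf fn0) E mulr1.
by rewrite -(bernsteinS muC (ltW z0)) opprB addrC subrK.
Qed.

Lemma Im_subV_eq0 w : complex.Im (w - w^-1) = 0 -> complex.Im w = 0.
Proof.
rewrite Im_subV => /eqP; rewrite mulf_eq0 => /orP[/eqP//|].
by rewrite gt_eqF// ltr_wpDr// invr_ge0 sqr_ge0.
Qed.

(** Suppose $f(z)$ is real. Then all $f(z+n)$ are, and integrating [Im_bkern_lower] gives $c_0 (m_k
    - q^k) \le q^n/(1 - q^2)$ for every $n$. This fails for large $n$ once $m_k > q^k$. *)
Lemma bernstein_Im_neq0 z : 0 < complex.Re z -> complex.Im z != 0 ->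
  complex.Im (f0 z) != 0.
Proof.
move=> z0 y0; apply/eqP => H.
have zn n : 0 < complex.Re (z + n%:R).
  by rewrite ReD Re_nat ltr_wpDr.
have Hn n : complex.Im (f0 (z + n%:R)) = 0.
  elim: n => [|n IH]; first by rewrite addr0.
  by apply: Im_subV_eq0; rewrite -natr1 addrA -bernstein_step.
set q := expR (- `|complex.Im z|^-1).
have q0 : 0 < q by exact: expR_gt0.
have q1 : q < 1 by rewrite expR_lt1 oppr_lt0 invr_gt0 normr_gt0.
have q21 : 0 < 1 - q ^+ 2 by rewrite subr_gt0 expr_lt1// ltW.
have [k mk] := @moment_not_geometric q (introT andP (conj q0 q1)).
set c0 := rpow q (complex.Re z) * `|complex.Im z| * cos 1.
have c00 : 0 < c0.
  by rewrite !mulr_gt0 ?cos1_gt0 ?normr_gt0// /rpow q0 expR_gt0.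
have key n : q ^+ n * c0 * (m k - q ^+ k) - q ^+ n * q ^+ n / (1 - q ^+ 2) <= 0.
  have [_ ib] := cintegrable01_bkern muC (ltW (zn n)).
  rewrite -[leRHS](mulr0 (Num.sg (complex.Im z))) -(Hn n).
  rewrite -[complex.Im (f0 _)]/(I (fun t => complex.Im (bkern (z + n%:R) t))).
  rewrite -(Rintegral01_exprn hm) -[q ^+ k](Rintegral01_cst muC) -[X in _ - X](Rintegral01_cst muC) -Rintegral01Z//.
  have i1 := integrable01_exprn muC k; have i2 := integrable01_cst muC (q ^+ k).
  rewrite -Rintegral01B// -Rintegral01Z//; last exact: integrable01B.
  rewrite -Rintegral01B//; [|by apply: integrable01Z; exact: integrable01B|exact: integrable01_cst].
  apply: le_Rintegral01.
  - by apply: integrable01B; [apply: integrable01Z; exact: integrable01B|exact: integrable01_cst].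
  - exact: integrable01Z.
  - by move=> t t01; exact: Im_bkern_lower.
have e0 : 0 < c0 * (m k - q ^+ k) * (1 - q ^+ 2).
  by apply: mulr_gt0 => //; apply: mulr_gt0 => //; rewrite subr_gt0.
have [n qn] : exists n, q ^+ n < c0 * (m k - q ^+ k) * (1 - q ^+ 2).
  by apply: exprn_small => //; rewrite ltW.
have := key n; rewrite subr_le0 -(mulrA _ c0) -(mulrA _ (q ^+ n)) ler_pM2l ?exprn_gt0//.
by rewrite ler_pdivlMr// leNgt qn.
Qed.

End ImaginaryPart.

(** * Meromorphic extension of $f$ and $F$ to the plane *)

Section Extension.
Variables (R : realType) (mu : probability R R) (m : nat -> R).
Local Open Scope complex_scope.
Hypothesis muC : mu (~` `[0%R, 1%R]) = 0%E.
Local Notation f0 := (bernstein mu).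
Hypothesis hm : forall n : nat,
  (\int[mu]_(t in `[0%R, 1%R]) (t ^+ n)%:E = (m n)%:E)%E.
Hypothesis m0 : m 0%N = 1.
Hypothesis m_gt0 : forall n, 0 < m n.
Hypothesis mrec : forall n, (0 < n)%N -> (1 + \sum_(1 <= k < n.+1) m k) * m n = 1.
Implicit Types (z w : R[i]) (n k : nat).

Definition psi w := w - w^-1.

(* Since [0^-1 = 0], [psi 0 = 0]: the extension takes the junk value [0] at its
   poles, so [z] is a pole exactly when [fext (z + 1) = 0]. *)
Definition fext z := let n := Num.bound `|complex.Re z| in iter n psi (f0 (z + n%:R)).

Lemma psi0 : psi 0 = 0.
Proof. by rewrite /psi invr0 subr0. Qed.

(** Independence of the shift: once $z + n$ is in the right half-plane, further steps undo each
    other by [bernstein_step]. *)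
Lemma iter_psi_shift z n k : 0 < complex.Re z + n%:R ->
  iter n psi (f0 (z + n%:R)) = iter (n + k) psi (f0 (z + (n + k)%:R)).
Proof.
move=> zn; elim: k => [|k ->]; first by rewrite addn0.
rewrite addnS iterSr -natr1 addrA -[psi _](bernstein_step muC hm m0 m_gt0 mrec)//.
by rewrite ReD Re_nat natrD addrA ltr_wpDr.
Qed.

Lemma fextE z n : 0 < complex.Re z + n%:R -> fext z = iter n psi (f0 (z + n%:R)).
Proof.
move=> zn; rewrite /fext; set b := Num.bound _.
have zb : 0 < complex.Re z + b%:R.
  have := archi_boundP (normr_ge0 (complex.Re z)); rewrite -/b.
  have := ler_norm (- complex.Re z); rewrite normrN; lra.
by rewrite (iter_psi_shift n zb) (iter_psi_shift b zn) addnC.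
Qed.

Lemma exists_shift z : exists n, 0 < complex.Re z + n%:R.
Proof.
exists (Num.bound `|complex.Re z|).
have := archi_boundP (normr_ge0 (complex.Re z)).
have := ler_norm (- complex.Re z); rewrite normrN; lra.
Qed.

Lemma fext_bernstein z : 0 < complex.Re z -> fext z = f0 z.
Proof. by move=> z0; rewrite (@fextE z 0) addr0. Qed.

(** A shift [n] for $z + 1$ is a shift [n.+1] for $z$. With the junk values, the equation holds at
    every point, poles included. *)
Lemma fextS z : fext z = psi (fext (z + 1)).
Proof.
have [n zn] := exists_shift (z + 1).
rewrite (fextE zn) (@fextE z n.+1) /=; last by move: zn; rewrite ReD/= -natr1; lra.
by rewrite -[n.+1]add1n natrD addrA.
Qed.

Lemma fext1 : fext 1 = 1.
Proof. by rewrite fext_bernstein ?ltr01// (bernstein1 muC). Qed.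

Lemma fext0 : fext 0 = 0.
Proof. by rewrite fextS add0r fext1 /psi invr1 subrr. Qed.

Lemma fext_Re_gt0_neq0 z : 0 < complex.Re z -> fext z != 0.
Proof.
move=> z0; rewrite fext_bernstein//; apply/eqP => H.
by have := bernstein_Re_gt0 muC z0; rewrite H ltxx.
Qed.

Lemma fext_Im_neq0 z : complex.Im z != 0 -> complex.Im (fext z) != 0.
Proof.
move=> y0; have [n] := exists_shift z.
elim: n z y0 => [|n IH] z y0 zn.
  rewrite addr0 in zn; rewrite fext_bernstein//.
  exact: (bernstein_Im_neq0 muC hm m0 m_gt0 mrec).
rewrite fextS; apply/eqP => /Im_subV_eq0/eqP; apply/negP; apply: IH.
  by rewrite ImD/= addr0.
by move: zn; rewrite ReD/= -natr1; lra.
Qed.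

Lemma fext_Im_eq0 z : complex.Im z = 0 -> complex.Im (fext z) = 0.
Proof.
have [n] := exists_shift z; elim: n z => [|n IH] z zn y0.
  rewrite addr0 in zn; rewrite fext_bernstein//.
  have -> : z = (complex.Re z)%:C by exact: complex_ext.
  exact: bernstein_Im_real.
rewrite fextS Im_subV IH ?mul0r//; last by rewrite ImD/= y0 addr0.
by move: zn; rewrite ReD/= -natr1; lra.
Qed.

Lemma fext_zero_real z : fext z = 0 -> complex.Im z = 0.
Proof.
move=> H; apply/eqP; apply: contraT => /fext_Im_neq0.
by rewrite H eqxx.
Qed.

(** This form is regular at $w = 0$ and serves at a zero of $f(z+1)$; [psi_inv_inv], written in
    $1/w$, serves at a pole. Both hold for all $w$ thanks to [0^-1 = 0]. *)
Lemma psi_inv w : (psi w)^-1 = w * (w * w - 1)^-1.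
Proof.
have [->|w0] := eqVneq w 0; first by rewrite psi0 invr0 mul0r.
by rewrite -[RHS]invrK invfM invrK /psi mulrBr mulr1 mulKf.
Qed.

Lemma psi_inv_inv w : (psi w)^-1 = w^-1 * (1 - w^-1 * w^-1)^-1.
Proof.
rewrite -[psi w]opprK opprB -[X in _ - X]invrK -/(psi w^-1) invrN psi_inv.
by rewrite -mulrN -invrN opprB.
Qed.

(* At each point [fext] or its inverse is holomorphic; on the real line the
   derivative of the former is positive, of the latter negative, because
   [psi' = 1 + 1/w^2] and [(1/psi)' (0) = -1]. *)
Definition regular_at z :=
  (fext (z + 1) != 0 -> exists2 d, cderive fext z d &
     (complex.Im z = 0 -> exists2 r : R, 0 < r & d = r%:C)) /\
  (fext (z + 1) = 0 -> exists2 r : R, 0 < r &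
     cderive (fun w => (fext w)^-1) z (- r%:C)).

Lemma regular_atP z : regular_at z.
Proof.
have [n] := exists_shift z; elim: n z => [|n IH] z zn.
  rewrite addr0 in zn; have z1 : 0 < complex.Re (z + 1) by rewrite ReD/=; lra.
  split; last by move=> H; have := fext_Re_gt0_neq0 z1; rewrite H eqxx.
  move=> _; exists (dbernstein mu z).
    apply: near_eq_is_derive (cderive_bernstein muC zn).
    near=> w; rewrite fext_bernstein//.
    have : `|z - w| < (complex.Re z)%:C.
      near: w; apply: (@filterS _ _ _ (ball (z : R[i]^o) (complex.Re z)%:C)).
        by move=> x; rewrite -ball_normE.
      by apply: nbhsx_ballx; rewrite ltcR.
    rewrite normc_cmod ltcR; have := Re_le_cmod (z - w); rewrite ReD ReN.
    have := ler_norm (complex.Re z - complex.Re w); lra.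
  move=> y0; have -> : z = (complex.Re z)%:C by exact: complex_ext.
  have [r r0 ->] := dbernstein_real muC hm m_gt0 zn.
  by exists r.
have {zn IH}[IH1 IH2] : regular_at (z + 1).
  by apply: IH; move: zn; rewrite ReD/= -natr1; lra.
have fE w : fext w = psi (fext (w + 1)) by exact: fextS.
split => [f1|f1].
  (* If $z + 1$ were a pole, [fext (z + 1)] would be the junk value 0. *)
  have f2 : fext (z + 1 + 1) != 0.
    by apply: contra_neq f1 => f2; rewrite fE f2 psi0.
  have [d Hd dr] := IH1 f2; have Hg := cderive_shift Hd.
  exists (d + - (- (fext (z + 1)) ^- 2 * d)).
    by apply: (cderive_ext (fun w => esym (fE w))); apply: cderiveD => //; apply: cderiveN; exact: cderiveV.
  move=> y0; have y1 : complex.Im (z + 1) = 0 by rewrite ImD y0 addr0.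
  have [r r0 ->] := dr y1; set a := complex.Re (fext (z + 1)).
  have E : fext (z + 1) = a%:C by apply: complex_ext => //; exact: fext_Im_eq0.
  exists (r + a ^- 2 * r).
    by rewrite ltr_wpDr// mulr_ge0 ?invr_ge0 ?sqr_ge0// ltW.
  by rewrite E mulNr opprK rmorphD rmorphM fmorphV rmorphXn.
have y1 : complex.Im (z + 1) = 0 by exact: fext_zero_real.
(* Either $z + 1$ is a pole, and $v/(1 - v^2)$ with slope 1 at 0 keeps the derivative $-r$ of the
   inverse; or it is a genuine zero, and $w/(w^2 - 1)$ with slope $-1$ turns $r$ into $-r$. *)
have [f2|f2] := eqVneq (fext (z + 1 + 1)) 0.
  have [r r0 Hr] := IH2 f2; exists r => //.
  have Hg := cderive_shift Hr.
  apply: (@cderive_ext _ (fun w => (fext (w + 1))^-1 * (1 - (fext (w + 1))^-1 * (fext (w + 1))^-1)^-1)).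
    by move=> w; rewrite [in RHS]fE psi_inv_inv.
  have d1 := cderiveD (cderive_cst 1 z) (cderiveN (cderiveM Hg Hg)).
  have d2 := cderiveM Hg (cderiveV _ d1).
  apply: cderive_eq (d2 _) _; rewrite f1 ?invr0 !mul0r ?subr0 ?oner_neq0//.
  by rewrite add0r invr1 mul1r.
have [d Hd /(_ y1) [r r0 dE]] := IH1 f2; exists r => //.
have Hg := cderive_shift Hd.
apply: (@cderive_ext _ (fun w => fext (w + 1) * (fext (w + 1) * fext (w + 1) - 1)^-1)).
  by move=> w; rewrite [in RHS]fE psi_inv.
have d1 := cderiveD (cderiveM Hg Hg) (cderive_cst (- 1) z).
have d2 := cderiveM Hg (cderiveV _ d1).
apply: cderive_eq (d2 _) _; rewrite f1 !mul0r ?sub0r ?oppr_eq0 ?oner_neq0//.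
by rewrite add0r invrN invr1 mulN1r dE.
Unshelve. all: by end_near. Qed.

(** A genuine zero is real, so the derivative there is positive. At a pole, where [fext] is 0 by
    convention, the inverse has derivative $-r \ne 0$. *)
Lemma fext_isolated z : exists2 r : R, 0 < r &
  forall w, cmod (w - z) < r -> w != z -> fext w != 0.
Proof.
have [H1 H2] := regular_atP z; have [f1|f1] := eqVneq (fext (z + 1)) 0.
  have [d d0 Hd] := H2 f1.
  have dn0 : - d%:C != 0 by rewrite oppr_eq0 gt_eqF// ltcR.
  have [r r0 Hr] := cderive_isolated Hd (or_intror dn0).
  by exists r => // w wr wz; have := Hr w wr wz; rewrite invr_eq0.
have [d Hd dr] := H1 f1; apply: (cderive_isolated Hd).
have [fz|fz] := eqVneq (fext z) 0; [right|by left].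
by have [r r0 ->] := dr (fext_zero_real fz); rewrite gt_eqF// ltcR.
Qed.

Lemma fext_zeros_isolated z : exists2 r : R, 0 < r &
  forall w, fext (w + 1) = 0 -> cmod (w - z) < r -> w = z.
Proof.
have [r r0 Hr] := fext_isolated (z + 1); exists r => // w fw wr.
apply/eqP; apply: contraT => wz; have := Hr (w + 1).
rewrite fw eqxx opprD addrACA subrr addr0 => /(_ wr); apply.
by rewrite (inj_eq (addIr _)).
Qed.

Lemma meromorphic_fext : meromorphic fext [set z | fext (z + 1) = 0].
Proof.
split => [z|z|z] /=; first exact: fext_zeros_isolated.
  by move=> /eqP f1; have [/(_ f1) [d Hd _] _] := regular_atP z; exact: cderive_cdiff Hd.
move=> f1; have [_ /(_ f1) [r r0 Hr]] := regular_atP z.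
apply: (pole_of_inv Hr); first by rewrite fextS f1 psi0 invr0.
by rewrite oppr_eq0 gt_eqF// ltcR.
Qed.

(** Only genuine zeros of $f$ at $z + 1$ are poles of $F$. Where $f$ has a pole at $z + 1$, the junk
    inverse 0 is the correct value of $F$, which is holomorphic there. *)
Lemma meromorphic_fext_inv : meromorphic (fun z => (fext (z + 1))^-1)
  [set z | fext (z + 1) = 0 /\ fext (z + 1 + 1) != 0].
Proof.
split => [z|z|z] /=.
- by have [r r0 Hr] := fext_zeros_isolated z; exists r => // w [fw _]; exact: Hr.
- move=> H; have [H1 H2] := regular_atP (z + 1).
  have [f2|f2] := eqVneq (fext (z + 1 + 1)) 0.
    have [r _ Hr] := H2 f2.
    exact: (cderive_cdiff (@cderive_shift _ (fun w => (fext w)^-1) z 1 _ Hr)).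
  have f1 : fext (z + 1) != 0 by apply/eqP => f1; apply: H.
  have [d Hd _] := H1 f2.
  exact: (cderive_cdiff (@cderive_shift _ (fun w => (fext w)^-1) z 1 _ (cderiveV f1 Hd))).
move=> [f1 f2]; have [/(_ f2) [d Hd dr] _] := regular_atP (z + 1).
apply: (@pole_of_inv _ _ _ d).
- by apply: (cderive_ext _ (cderive_shift Hd)) => w; rewrite invrK.
- by rewrite invrK.
by have [r r0 ->] := dr (fext_zero_real f1); rewrite gt_eqF// ltcR.
Qed.

End Extension.

(** * The extensions [fext] and $1/f(z+1)$ satisfy all the claims *)

Theorem theorem1p1 (R : realType) (m : nat -> R) (mu : probability R R) :
  m 0%N = 1 ->
  (forall n, 0 < m n) ->
  (forall n, (0 < n)%N -> (1 + \sum_(1 <= k < n.+1) m k) * m n = 1) ->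
  mu (~` `[0%R, 1%R]) = 0%E ->
  (forall n : nat, (\int[mu]_(t in `[0%R, 1%R]) (t ^+ n)%:E = (m n)%:E)%E) ->
  exists (f F : R[i] -> R[i]) (Pf PF : set R[i]),
    meromorphic f Pf /\ meromorphic F PF /\
        (forall z : R[i], 0 < complex.Re z ->
            f z = bernstein mu z /\ F z = mellin mu z) /\
        (forall z : R[i], ~ Pf (z + 1) -> ~ PF z -> f (z + 1) * F z = 1) /\
        (forall z : R[i], ~ Pf z -> ~ Pf (z + 1) -> f (z + 1) != 0 ->
            f z = f (z + 1) - (f (z + 1))^-1) /\
        (forall z : R[i], -1 < complex.Re z -> ~ Pf z /\ ~ PF z) /\
        Pf (-1) /\ PF (-1) /\
        (forall x : R, -1 < x -> (\int[mu]_(t in `[0%R, 1%R]) (rpow t x)%:E < +oo)%E) /\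
        (\int[mu]_(t in `[0%R, 1%R]) (t^-1)%:E = +oo)%E.
Proof.
move=> m0 m_gt0 mrec muC hm.
exists (fext mu), (fun z => (fext mu (z + 1))^-1), [set z | fext mu (z + 1) = 0],
  [set z | fext mu (z + 1) = 0 /\ fext mu (z + 1 + 1) != 0].
have fS := fextS muC hm m0 m_gt0 mrec.
split; first exact: (meromorphic_fext muC hm m0 m_gt0 mrec).
split; first exact: (meromorphic_fext_inv muC hm m0 m_gt0 mrec).
split.
  move=> z z0; have z1 : 0 < complex.Re (z + 1) by rewrite ReD/=; lra.
  have fn0 := fext_Re_gt0_neq0 muC hm m0 m_gt0 mrec z1.
  have fE := fext_bernstein muC hm m0 m_gt0 mrec; split; first exact: fE.
  rewrite fE// in fn0 *; apply: (mulfI fn0).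
  by rewrite mulfV// (bernstein_mellin muC hm m0 m_gt0 mrec).
split.
  move=> z /= /eqP f2 H; rewrite mulfV//; apply/eqP => f1; exact: H.
split; first by move=> z _ _ _; exact: fS.
split.
  move=> z z1; suff f1 : fext mu (z + 1) != 0.
    by split => [/=|[]] /eqP; rewrite (negbTE f1).
  by apply: (fext_Re_gt0_neq0 muC hm m0 m_gt0 mrec); rewrite ReD/=; lra.
(* From $f(0) = 0$, the point $-1$ is a pole of $f$; as $f(1) = 1$, the zero at 0 is genuine, and
   $-1$ is a pole of $F$ too. *)
have f0 := fext0 muC hm m0 m_gt0 mrec.
split; first by rewrite /= addNr.
split; first by rewrite /= addNr f0 add0r (fext1 muC hm m0 m_gt0 mrec) oner_neq0.
split; first exact: (mellin_rpow_lty muC hm m0 m_gt0 mrec).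
exact: (mellin_inv_infty muC hm m0 m_gt0 mrec).
Qed.
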